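(* Let $p\ge1$ and let $q\in(1,\infty]$ satisfy $\frac1p+\frac1q=1$. For every locally anti-blocking body $K\subset\mathbb{R}^n$, $$|K\oplus_p(-K)|\le\kappa_{n,q}\,|K|,\qquad\text{where}\qquad \kappa_{n,q}=\sum_{i=0}^n\binom{n/q}{i/q}^{-1}\binom ni^2.$$ Moreover, $\kappa_{n,q}$ is the best possible (smallest) constant for which this holds for all locally anti-blocking bodies $K\subset\mathbb{R}^n$.
   Context: $\mathbb{R}^n_+=[0,\infty)^n$. A convex body is a nonempty compact convex set. A coordinate subspace is one spanned by a subset of the standard basis. A convex body $K\subset\mathbb{R}^n_+$ is anti-blocking if $P_EK=K\cap E$ for every coordinate subspace $E$ ($P_E$ the orthogonal projection onto $E$). For $\delta\in\{-1,1\}^n$ and $S\subset\mathbb{R}^n$, $\delta S=\{(\delta_1x_1,\dots,\delta_nx_n):x\in S\}$. A convex body $K\subset\mathbb{R}^n$ is locally anti-blocking if $\delta K\cap\mathbb{R}^n_+$ is anti-blocking for every $\delta\in\{-1,1\}^n$. The $L_p$-sum of $K,L\subset\mathbb{R}^n$ is, for $p>1$, $K\oplus_pL=\{(1-t)^{1/q}x+t^{1/q}y:x\in K,y\in L,t\in[0,1]\}$; for $p=1$, $K\oplus_1L=K+L$ is the Minkowski sum. Binomials with real entries: $\binom xy=\frac{\Gamma(x+1)}{\Gamma(y+1)\Gamma(x-y+1)}$; for $q=\infty$, $x/q=0$. $|\cdot|$ is $n$-dimensional Lebesgue measure. *)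

(* Defs.v *)
From HB Require Import structures.
From mathcomp Require Import all_boot all_order all_algebra.
From mathcomp Require Import all_classical all_reals all_analysis.

Set Implicit Arguments.
Unset Strict Implicit.
Unset Printing Implicit Defensive.

Import Order.TTheory GRing.Theory Num.Theory.
Import numFieldNormedType.Exports.

Local Open Scope classical_set_scope.
Local Open Scope ring_scope.

Section LebesgueStep.
Context {R : realType} (n : nat).
Variable m : {sigma_finite_measure set (n.-tuple (measurableTypeR R)) -> \bar R}.

Definition tuple_cons (z : measurableTypeR R * n.-tuple (measurableTypeR R)) :
  n.+1.-tuple (measurableTypeR R) := [tuple of z.1 :: z.2].

Lemma measurable_tuple_cons : measurable_fun setT tuple_cons.
Proof. exact: measurable_cons. Qed.

Definition lebesgue_step : set (n.+1.-tuple (measurableTypeR R)) -> \bar R :=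
  pushforward (lebesgue_measure \x m)%E tuple_cons.

Let step0 : lebesgue_step set0 = 0%E.
Proof. by rewrite /lebesgue_step /pushforward preimage_set0 measure0. Qed.

Let step_ge0 A : (0 <= lebesgue_step A)%E.
Proof. by rewrite /lebesgue_step /pushforward; exact: measure_ge0. Qed.

Let step_additive : semi_sigma_additive lebesgue_step.
Proof.
move=> F mF tF mUF; rewrite /lebesgue_step /pushforward preimage_bigcup.
apply: measure_semi_sigma_additive.
- by move=> k; rewrite -[X in measurable X]setTI; exact: measurable_tuple_cons.
- apply/trivIsetP => /= i j _ _ ij; rewrite -preimage_setI.
  by move/trivIsetP : tF => /(_ _ _ _ _ ij) ->//; rewrite preimage_set0.
- by rewrite -preimage_bigcup -[X in measurable X]setTI;
    exact: measurable_tuple_cons.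
Qed.

HB.instance Definition _ :=
  isMeasure.Build _ _ _ lebesgue_step step0 step_ge0 step_additive.

Let tuple_uncons (t : n.+1.-tuple (measurableTypeR R)) :
  measurableTypeR R * n.-tuple (measurableTypeR R) :=
  (thead t, [tuple of behead t]).

Let step_sigma_finite : sigma_finite setT lebesgue_step.
Proof.
have [F FT mF] : sigma_finite setT (lebesgue_measure \x m)%E.
  (* reproved: instance resolution on [_ \x _] finds the structure declared for
     products of subprobabilities instead of the sigma-finite one *)
  have /sigma_finiteP[F [TF ndF Foo]] := sigma_finiteT (@lebesgue_measure R).
  have /sigma_finiteP[G [TG ndG Goo]] := sigma_finiteT m.
  exists (fun k => F k `*` G k).
    rewrite -setXTT TF TG predeqE => -[x y]; split.
      move=> [/= [i _ Fix] [k _ Gky]]; exists (maxn i k) => //; split.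
      - by move: x Fix; exact/subsetPset/ndF/leq_maxl.
      - by move: y Gky; exact/subsetPset/ndG/leq_maxr.
    by move=> [i _ []/= ? ?]; split; exists i.
  move=> k; have [? ?] := Foo k; have [? ?] := Goo k.
  split; first exact: measurableX.
  by rewrite product_measure1E// lte_mul_pinfty// ge0_fin_numE.
have uncons_consK : cancel tuple_cons tuple_uncons.
  by move=> [x t]; congr pair; apply/val_inj.
have cons_unconsK : cancel tuple_uncons tuple_cons.
  by move=> t; rewrite [RHS]tuple_eta.
have muncons : measurable_fun setT tuple_uncons.
  apply/measurable_fun_pairP; split; first exact: measurable_tnth.
  exact: measurable_behead.
exists (fun k => tuple_uncons @^-1` F k).
  by rewrite -preimage_bigcup -FT preimage_setT.
move=> k; have [mFk Fkoo] := mF k; split.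
  by rewrite -[X in measurable X]setTI; exact: muncons.
rewrite /lebesgue_step /pushforward -comp_preimage.
by rewrite (_ : tuple_uncons \o tuple_cons = id) //; exact/funext.
Qed.

HB.instance Definition _ :=
  Measure_isSigmaFinite.Build _ _ _ lebesgue_step step_sigma_finite.

End LebesgueStep.

(* Lebesgue measure on R^n, as the n-fold product of the one on R. *)
Fixpoint lebesgueRn (R : realType) (n : nat) :
    {sigma_finite_measure set (n.-tuple (measurableTypeR R)) -> \bar R} :=
  if n is m.+1 then lebesgue_step (lebesgueRn R m) else \d_[tuple].

Section Definitions.
Context {R : realType}.

Definition volume n (A : set 'rV[R]_n) : \bar R :=
  lebesgueRn R n [set t | A (\row_i tnth t i)].

(* Together with [lebesgueRn] being a sigma-finite measure, this determines
   [volume] on Borel sets; in particular on all compact sets. *)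
Lemma volume_rect n (A : 'I_n -> set R) :
  (forall i, measurable (A i)) ->
  volume [set x | forall i, A i (x 0 i)] = (\prod_i lebesgue_measure (A i))%E.
Proof.
rewrite /volume; elim: n A => [|n IHn] A mA /=.
  by rewrite big_ord0 diracE mem_set // => -[].
rewrite big_ord_recl -IHn// -product_measure1E//; last first.
  rewrite (_ : mkset _ = \bigcap_(i in [set: 'I_n])
      ((fun t : n.-tuple (measurableTypeR R) => tnth t i) @^-1`
        A (lift ord0 i))).
    apply: fin_bigcap_measurable => [|i _]; first exact: finite_finset.
    rewrite -[X in measurable X]setTI.
    by apply: (@measurable_tnth _ (measurableTypeR R) n i) => //; exact: mA.
  by apply/seteqP; split=> t /= At i; [move=> _|]; have := At i; rewrite /= mxE//;
    apply.
  exact: mA.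
rewrite /lebesgue_step /pushforward; congr (product_measure1 _ _ _).
apply/seteqP; split=> -[x t] /=.
  move=> At; split; first by have := At ord0; rewrite mxE tnth0.
  by move=> i; have := At (lift ord0 i); rewrite !mxE tnthS.
move=> [Ax At] i; rewrite mxE.
by case: (unliftP ord0 i) => [j ->|->]; [have := At j; rewrite mxE tnthS|rewrite tnth0].
Qed.

Definition convex_body n (K : set 'rV[R]_n) : Prop :=
  [/\ K !=set0, compact K & convex_set K].

Definition nonneg_orthant n : set 'rV[R]_n := [set x | forall i, 0 <= x 0 i].

Definition coord_subspace n (I : {set 'I_n}) : {vspace 'rV[R]_n} :=
  span [seq delta_mx 0 i | i <- enum I].

(* The image of K under the orthogonal projection onto E. *)
Definition proj_image n (E : {vspace 'rV[R]_n}) (K : set 'rV[R]_n) :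
    set 'rV[R]_n :=
  [set y | y \in E /\
    exists2 x, K x & forall z, z \in E -> (x - y) *m z^T = 0].

Definition anti_blocking n (K : set 'rV[R]_n) : Prop :=
  [/\ convex_body K, K `<=` @nonneg_orthant n &
      forall I : {set 'I_n}, proj_image (coord_subspace I) K =
        K `&` [set x | x \in coord_subspace I]].

Definition neg_set n (S : set 'rV[R]_n) : set 'rV[R]_n := [set - x | x in S].

Definition coord_scale n (d : 'rV[R]_n) (S : set 'rV[R]_n) : set 'rV[R]_n :=
  [set \row_i (d 0 i * x 0 i) | x in S].

Definition locally_anti_blocking n (K : set 'rV[R]_n) : Prop :=
  convex_body K /\
  forall d : 'rV[R]_n, (forall i, d 0 i = 1 \/ d 0 i = -1) ->
    anti_blocking (coord_scale d K `&` @nonneg_orthant n).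

(* 1/q for q in (1, +oo], where 1/(+oo) = 0. *)
Definition rinv (q : \bar R) : R := fine (q^-1)%E.

Definition Lp_sum n (p : R) (q : \bar R) (K L : set 'rV[R]_n) :
    set 'rV[R]_n :=
  if p == 1 then [set x + y | x in K & y in L]
  else [set z | exists x y t, [/\ K x, L y, 0 <= t <= 1 &
         z = ((1 - t) `^ rinv q) *: x + (t `^ rinv q) *: y]].

(* Euler's integral, i.e. the Gamma function for x > 0 only. *)
Definition Gamma (x : R) : R :=
  \int[lebesgue_measure]_(t in `]0, +oo[) (t `^ (x - 1) * expR (- t)).

Definition rbin (x y : R) : R :=
  Gamma (x + 1) / (Gamma (y + 1) * Gamma (x - y + 1)).

Definition kappa (n : nat) (q : \bar R) : R :=
  \sum_(i < n.+1)
    (rbin (n%:R * rinv q) (i%:R * rinv q))^-1 * ('C(n, i)%:R) ^+ 2.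

End Definitions.

(* Main.v *)
(** Put r = 1/q. Both sums are the set of all (1 - t)^r x + t^r y (for p = 1 because 0^0 = 1), and a
    locally anti-blocking body is a convex body K stable under x |-> (l_i x_i) with l in [0, 1]^n.

    Cutting K by a coordinate hyperplane into K+ and K-, Fubini along that coordinate gives
    |K (+) -K| <= |K+ (+) -K+| + |K- (+) -K-|, so K may be assumed to lie in one orthant. There
    K (+) -K splits into orthants indexed by coordinate sets E, and up to a reflection the part of
    index E is T_r(E), the sum of the projections of K to E and to its complement. With i = #|E| and
    V(E) the volume of the product of these projections, integrating exp(-s) over dilates gives
      |T_r(E)| Gamma(n r + 1) = Gamma(i r + 1) Gamma((n - i) r + 1) V(E).
    For r = 1 the set T_1(E) is contained in K by convexity, hence V(E) <= C(n, i) |K|, and summing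
    over E yields kappa. For the simplex T_1(E) = K and all the inequalities are equalities. *)
Require Import Defs.
From mathcomp Require Import all_boot all_order all_algebra.
From mathcomp Require Import all_classical all_reals all_analysis.
From mathcomp Require Import measurable_realfun ring lra.

Import Order.TTheory GRing.Theory Num.Theory.
Import numFieldNormedType.Exports.
Local Open Scope classical_set_scope.
Local Open Scope ring_scope.

Set Implicit Arguments.
Unset Strict Implicit.
Unset Printing Implicit Defensive.

(** * Lebesgue measure on R^n *)

(** Why one orthant: a coordinate of a point of the sum is a u_i - b v_i with a, b >= 0. If u_i and
    v_i have the same sign, it lies between 0 and one of the two terms, so that shrinking u or v
    alone reaches it; with opposite signs the terms add up and no such choice of E exists. The cut
    costs nothing in the constant, because the volumes of the two halves add up to that of K. Why
    exponentials: the least s with z in s^r A acts as a gauge of A. The gauge of T_r(E) at z is the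
    sum of the gauges of K at the two blocks of z, so exp of its opposite is a product, and Tonelli
    separates the blocks; each block of dimension k contributes the integral of s^(k r) exp(-s), a
    Gamma value. Sets of admissible s are used in place of gauge functions: they are up-sets of the
    half-line, which also covers r = 0, where such a set is empty or everything. Why V(E): it does
    not depend on r, whereas convexity says something only about r = 1. It carries the information
    from r = 1 to r = 1/q. *)

Section Lebesgue1.
Context {R : realType}.
Notation T := (measurableTypeR R).
Notation lambda := (@lebesgue_measure R).

Lemma lebesgue_measure_scale (d : R) (A : set T) : d != 0 -> measurable A ->
  lambda (( *%R d) @^-1` A) = (`|d|^-1%:E * lambda A)%E.
Proof.
move=> d0 mA.
have dp : 0 < `|d| by rewrite normr_gt0.
pose f := ( *%R d : T -> T).
have mf : measurable_fun setT f by exact: mulrl_measurable.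
(* By uniqueness of Lebesgue measure: the pushforward under multiplication by d, rescaled by |d|,
   gives every interval ]a, b] its length. *)
have -> : lambda A = (`|d|%:E * lambda (f @^-1` A))%E.
  pose pm := (pushforward lambda f : {measure set T -> \bar R}).
  pose m := mscale (NngNum (normr_ge0 d)) (pm mf).
  have H := @lebesgue_measure_unique R m.
  apply: H mA.
  move=> _ [[a b] _ <-].
  change (lambda `]a, b] = (`|d|%:E * lambda (f @^-1` `]a, b]))%E).
  have [dpos|dneg] : 0 < d \/ d < 0 by apply/orP; rewrite -neq_lt eq_sym.
    rewrite (_ : f @^-1` _ = `]a / d, b / d]%classic); last first.
      apply/seteqP; split => x /=; rewrite !in_itv/= /f.
        by rewrite ltr_pdivrMr// ler_pdivlMr// ![_ * d]mulrC.
      by rewrite ltr_pdivrMr// ler_pdivlMr// ![_ * d]mulrC.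
    rewrite !lebesgue_measure_itv/= !lte_fin ltr_pM2r ?invr_gt0//.
    case: ifP => _; last by rewrite mule0.
    by rewrite -!EFinB -EFinM gtr0_norm// -mulrBl mulrCA divff ?mulr1.
  rewrite (_ : f @^-1` _ = `[b / d, a / d[%classic); last first.
    apply/seteqP; split => x /=; rewrite !in_itv/= /f.
      by rewrite ler_ndivrMr// ltr_ndivlMr// ![_ * d]mulrC andbC.
    by rewrite ler_ndivrMr// ltr_ndivlMr// ![_ * d]mulrC andbC.
  rewrite !lebesgue_measure_itv/= !lte_fin ltr_nM2r ?invr_lt0//.
  case: ifP => _; last by rewrite mule0.
  rewrite -!EFinB -EFinM ltr0_norm// -mulrBl mulrCA mulNr divff ?mulr1//.
  by rewrite mulrN1 opprB.
by rewrite muleA -EFinM mulVf ?gt_eqF// mul1e.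
Qed.

End Lebesgue1.

Section LebesgueRn.
Context {R : realType}.
Notation T := (measurableTypeR R).
Notation lambda := (@lebesgue_measure R).
Notation mu n := (lebesgueRn R n).

Lemma measurable_tuple_ord n (d0 : measure_display) (X : measurableType d0)
    (f : 'I_n -> X -> T) :
  (forall i, measurable_fun setT (f i)) ->
  measurable_fun setT (fun x => [tuple f i x | i < n] : n.-tuple T).
Proof.
move=> mf; apply/measurable_fun_tnthP => i.
by rewrite (_ : _ \o _ = f i)//; apply/funext => x /=; rewrite tnth_mktuple.
Qed.

Lemma measurable_consl n (A : set (n.+1.-tuple T)) (x : T) :
  measurable A -> measurable [set t : n.-tuple T | A [tuple of x :: t]].
Proof.
move=> mA; rewrite -[X in measurable X]setTI.
apply: (measurable_cons (T1 := n.-tuple T) (T2 := T) (f := cst x) (g := idfun)) => //.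
exact: measurable_id.
Qed.

Lemma measurable_consr n (A : set (n.+1.-tuple T)) (t : n.-tuple T) :
  measurable A -> measurable [set x : T | A [tuple of x :: t]].
Proof.
move=> mA; rewrite -[X in measurable X]setTI.
apply: (measurable_cons (T1 := T) (T2 := T) (f := idfun) (g := cst t)) => //.
exact: measurable_id.
Qed.

Lemma xsection_cons n (A : set (n.+1.-tuple T)) (x : T) :
  xsection (@tuple_cons R n @^-1` A) x = [set t : n.-tuple T | A [tuple of x :: t]].
Proof. by apply/seteqP; split => t; rewrite /xsection/= inE. Qed.

Lemma ysection_cons n (A : set (n.+1.-tuple T)) (t : n.-tuple T) :
  ysection (@tuple_cons R n @^-1` A) t = [set x : T | A [tuple of x :: t]].
Proof. by apply/seteqP; split => x; rewrite /ysection/= inE. Qed.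

Lemma measurable_preimage_cons n (A : set (n.+1.-tuple T)) :
  measurable A -> measurable (@tuple_cons R n @^-1` A).
Proof.
by move=> mA; rewrite -[X in measurable X]setTI; exact: measurable_tuple_cons.
Qed.

Lemma measurable_lebesgueRn_consl n (A : set (n.+1.-tuple T)) : measurable A ->
  measurable_fun setT (fun x : T => mu n [set t : n.-tuple T | A [tuple of x :: t]]).
Proof.
move=> /measurable_preimage_cons mA.
have := @measurable_fun_xsection _ _ T (n.-tuple T) R (mu n) _ mA.
by rewrite (_ : _ \o _ = fun x : T => mu n [set t : n.-tuple T | A [tuple of x :: t]])//;
  apply/funext => x /=; rewrite xsection_cons.
Qed.

Lemma measurable_lebesgueRn_consr n (A : set (n.+1.-tuple T)) : measurable A ->
  measurable_fun setT (fun t : n.-tuple T => lambda [set x : T | A [tuple of x :: t]]).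
Proof.
move=> /measurable_preimage_cons mA.
have := @measurable_fun_ysection _ _ T (n.-tuple T) R lambda _ mA.
by rewrite (_ : _ \o _ = fun t : n.-tuple T => lambda [set x : T | A [tuple of x :: t]])//;
  apply/funext => t /=; rewrite ysection_cons.
Qed.

Lemma lebesgueRnS n (A : set (n.+1.-tuple T)) :
  mu n.+1 A = (\int[lambda]_x mu n [set t : n.-tuple T | A [tuple of x :: t]])%E.
Proof.
rewrite [LHS]/= /lebesgue_step /pushforward /product_measure1.
by apply: eq_integral => x _ /=; rewrite xsection_cons.
Qed.

(** Both orders of integration agree on rectangles, hence everywhere. With the head coordinate
    innermost, one-dimensional facts apply to it. *)
Lemma lebesgueRnSr n (A : set (n.+1.-tuple T)) : measurable A ->
  mu n.+1 A = (\int[mu n]_t lambda [set x : T | A [tuple of x :: t]])%E.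
Proof.
move=> /measurable_preimage_cons mA.
transitivity ((lambda \x^ mu n)%E (@tuple_cons R n @^-1` A)).
  rewrite [LHS]/= /lebesgue_step /pushforward.
  by apply: product_measure_unique => // B C mB mC; exact: product_measure2E.
rewrite /product_measure2.
by apply: eq_integral => x _ /=; rewrite ysection_cons.
Qed.

Definition tscale n (d : 'I_n -> R) (t : n.-tuple T) : n.-tuple T :=
  [tuple d i * tnth t i | i < n].

Lemma measurable_tscale n (d : 'I_n -> R) : measurable_fun setT (tscale d).
Proof.
apply: measurable_tuple_ord => i.
apply: (measurableT_comp (mulrl_measurable (d i))).
exact: (@measurable_tnth _ T n i).
Qed.

Lemma measurable_preimage_tscale n (d : 'I_n -> R) (A : set (n.-tuple T)) :
  measurable A -> measurable (tscale d @^-1` A).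
Proof.
by move=> mA; rewrite -[X in measurable X]setTI; exact: measurable_tscale.
Qed.

Lemma tscale_cons n (d : 'I_n.+1 -> R) x (t : n.-tuple T) :
  tscale d [tuple of x :: t] =
  [tuple of (d ord0 * x) :: tscale (fun i => d (lift ord0 i)) t].
Proof.
apply: eq_from_tnth => i; rewrite tnth_mktuple.
by case: (unliftP ord0 i) => [j ->|->]; rewrite ?tnthS ?tnth0// tnth_mktuple.
Qed.

Lemma lebesgueRn_scale n (d : 'I_n -> R) (A : set (n.-tuple T)) :
  (forall i, d i != 0) -> measurable A ->
  mu n (tscale d @^-1` A) = ((\prod_i `|d i|^-1)%:E * mu n A)%E.
Proof.
elim: n d A => [|n IHn] d A d0 mA.
  rewrite big_ord0 mul1e (_ : tscale d @^-1` A = A)//.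
  by apply/seteqP; split => t /=; rewrite (tuple0 (tscale _ _)) (tuple0 t).
pose d' (i : 'I_n) := d (lift ord0 i).
(* Intermediate set where only the tail is rescaled: it is compared with the full preimage along the
   head, and with A by induction. *)
pose D := [set t : n.+1.-tuple T |
  A [tuple of thead t :: tscale d' [tuple of behead t]]].
have DE (x : T) (t : n.-tuple T) : D [tuple of x :: t] = A [tuple of x :: tscale d' t].
  rewrite /D/= theadE; congr (A [tuple of _ :: tscale d' _]).
  exact/val_inj.
have mD : measurable D.
  rewrite -[X in measurable X]setTI.
  apply: (measurable_cons (T1 := n.+1.-tuple T) (T2 := T)
    (f := fun t : n.+1.-tuple T => thead t)
    (g := fun t : n.+1.-tuple T => tscale d' [tuple of behead t])) => //.
    exact: (@measurable_tnth _ T n.+1 ord0).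
  apply: (measurableT_comp (measurable_tscale d')).
  exact: measurable_behead.
rewrite big_ord_recl EFinM -muleA.
transitivity (`|d ord0|^-1%:E * mu n.+1 D)%E.
  rewrite !lebesgueRnSr//; last exact: measurable_preimage_tscale.
  rewrite -ge0_integralZl//; last exact: measurable_lebesgueRn_consr.
  apply: eq_integral => t _; rewrite -lebesgue_measure_scale//.
    by congr lambda; apply/seteqP; split => x; rewrite /= tscale_cons DE.
  exact: measurable_consr.
congr (_ * _)%E; rewrite !lebesgueRnS -ge0_integralZl//.
- apply: eq_integral => x _; rewrite -IHn//; last exact: measurable_consl.
  by congr (mu n _); apply/seteqP; split => t; rewrite /= DE.
- exact: measurable_lebesgueRn_consl.
- by rewrite lee_fin; apply: prodr_ge0.
Qed.

Definition tuple_set_coord n (t : n.-tuple T) (k : 'I_n) (c : T) : n.-tuple T :=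
  [tuple if i == k then c else tnth t i | i < n].

(** The inequality between lengths on lines in direction k is integrated over the other coordinates.
    If k is the head, it is integrated innermost; otherwise the head is fixed and the induction
    applies to sections. *)
Lemma le_lebesgueRn_fibre n (k : 'I_n) (A B C : set (n.-tuple T)) :
  measurable A -> measurable B -> measurable C ->
  (forall t, (lambda [set c | A (tuple_set_coord t k c)] <=
     lambda [set c | B (tuple_set_coord t k c)] + lambda [set c | C (tuple_set_coord t k c)])%E) ->
  (mu n A <= mu n B + mu n C)%E.
Proof.
elim: n k A B C => [[] []//|n IHn] k A B C mA mB mC H.
case: (unliftP ord0 k) => [j kE|kE]; last first.
  rewrite !lebesgueRnSr// -ge0_integralD//.
  - apply: ge0_le_integral => //.
    + exact: measurable_lebesgueRn_consr.
    + by apply: emeasurable_funD; exact: measurable_lebesgueRn_consr.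
    (* The head 0 is a placeholder: [tuple_set_coord] overwrites it. *)
    + move=> t _; have := H [tuple of 0 :: t].
      suff E c : tuple_set_coord [tuple of 0 :: t] k c = [tuple of c :: t].
        have E' (D : set (n.+1.-tuple T)) : [set c | D (tuple_set_coord [tuple of 0 :: t] k c)] =
            [set c : T | D [tuple of c :: t]].
          by apply/seteqP; split => c /=; rewrite E.
        by rewrite !E'.
      apply: eq_from_tnth => i; rewrite tnth_mktuple kE.
      by case: (unliftP ord0 i) => [l ->|->]; rewrite ?tnthS ?tnth0 ?eqxx.
  - exact: measurable_lebesgueRn_consr.
  - exact: measurable_lebesgueRn_consr.
rewrite !lebesgueRnS// -ge0_integralD//.
- apply: ge0_le_integral => //.
  + exact: measurable_lebesgueRn_consl.
  + by apply: emeasurable_funD; exact: measurable_lebesgueRn_consl.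
  + move=> x _; apply: (IHn j); try exact: measurable_consl.
    move=> t; have := H [tuple of x :: t].
    suff E c : tuple_set_coord [tuple of x :: t] k c = [tuple of x :: tuple_set_coord t j c].
      have E' (D : set (n.+1.-tuple T)) : [set c | D (tuple_set_coord [tuple of x :: t] k c)] =
          [set c | D [tuple of x :: tuple_set_coord t j c]].
        by apply/seteqP; split => c /=; rewrite E.
      by rewrite !E'.
    apply: eq_from_tnth => i; rewrite tnth_mktuple kE.
    case: (unliftP ord0 i) => [l ->|->]; rewrite ?tnthS ?tnth0//.
    by rewrite tnth_mktuple (inj_eq lift_inj).
- exact: measurable_lebesgueRn_consl.
- exact: measurable_lebesgueRn_consl.
Qed.

End LebesgueRn.

(** * Closed and compact sets of row vectors *)

Section Topology.
Context {R : realType}.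
Notation T := (measurableTypeR R).

Lemma rV_continuous (X : topologicalType) n (f : X -> 'rV[R]_n) :
  (forall i, continuous (fun x => f x 0 i)) -> continuous f.
Proof.
move=> cf x A [P xP PA].
have : \forall y \near x, forall i, P 0 i (f y 0 i).
  by apply: filter_forall => i; exact: cf (xP 0 i).
by apply: filterS => y Py; apply: PA => i j; rewrite ord1.
Qed.

(** Topology and convexity live on row vectors, measurability on tuples; this is the bridge. *)
Definition rowset n (A : set 'rV[R]_n) : set (n.-tuple T) :=
  [set t | A (\row_i tnth t i)].

(** Tuples carry the product sigma-algebra, so an open set is written as the countable union of the
    cubes with rational centre and radius 1/(k+1) that it contains. *)
Lemma measurable_rowset_open n (A : set 'rV[R]_n) :
  open A -> measurable (rowset A).
Proof.
move=> oA.
pose box (qk : n.-tuple rat * nat) : set (n.-tuple T) :=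
  [set t | forall i, `|ratr (tnth qk.1 i) - tnth t i| < qk.2.+1%:R^-1].
pose F qk := if `[< box qk `<=` rowset A >] then box qk else set0.
have -> : rowset A = \bigcup_qk F qk.
  apply/seteqP; split => [t At|t [qk _]]; last first.
    by rewrite /F; case: asboolP => // + bt; exact.
  have /nbhs_ballP[e /= e0 eA] := open_nbhs_nbhs (conj oA At).
  have e20 : 0 < e / 2 by rewrite divr_gt0.
  have [k] := ltr_add_invr e20; rewrite add0r => ke.
  have k0 : 0 < k.+1%:R^-1 :> R by rewrite invr_gt0.
  have qP i : exists q : rat, `|ratr q - tnth t i| < k.+1%:R^-1.
    have [|q] := @rat_in_itvoo R (tnth t i - k.+1%:R^-1) (tnth t i).
      by rewrite gtrBl.
    by move=> /itvP qE; exists q; rewrite ltr_distl qE/= ltr_wpDr// ?qE// ltW.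
  have [q qE] := choice qP.
  have bt : box ([tuple q i | i < n], k) t.
    by move=> i /=; rewrite tnth_mktuple.
  exists ([tuple q i | i < n], k) => //; rewrite /F; case: asboolP => // + .
  case=> s bs; apply: eA; split => //= i j; rewrite !mxE /ball/=.
  rewrite (splitr e) (@le_lt_trans _ _ (`|ratr (q j) - tnth t j| + `|ratr (q j) - tnth s j|))//.
    by rewrite [X in _ <= X + _]distrC ler_distD.
  have /= := bs j; rewrite tnth_mktuple => sq.
  by rewrite ltrD// (lt_trans _ ke).
apply: countable_bigcupT_measurable => [|qk]; first exact: countableP.
rewrite /F; case: asboolP => // _.
rewrite (_ : box qk = \bigcap_(i in [set: 'I_n])
    ((fun t : n.-tuple T => tnth t i) @^-1`
      ball (ratr (tnth qk.1 i) : R) qk.2.+1%:R^-1)).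
  apply: fin_bigcap_measurable => [|i _]; first exact: finite_finset.
  rewrite -[X in measurable X]setTI.
  by apply: (@measurable_tnth _ T n i) => //; exact: measurable_ball.
by apply/seteqP; split=> t /= bt i; [move=> _|]; apply: bt.
Qed.

Lemma measurable_rowset_closed n (A : set 'rV[R]_n) :
  closed A -> measurable (rowset A).
Proof.
move=> cA; rewrite (_ : rowset A = ~` rowset (~` A)).
  by apply: measurableC; apply: measurable_rowset_open; rewrite openC.
by apply/seteqP; split => t /=; rewrite /rowset/=; [move=> ? []|move/contrapT].
Qed.

Lemma measurable_rowset_compact n (A : set 'rV[R]_n) :
  compact A -> measurable (rowset A).
Proof.
move=> cA; apply: measurable_rowset_closed; apply: compact_closed cA.
exact: norm_hausdorff.
Qed.

(** [powR] has the default value 1 at a negative base. Truncating the base at 0 gives a function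
    continuous on all of R, with which [power_sum] becomes a continuous image of a compact
    product. *)
Lemma continuous_powR_max (r : R) : 0 <= r ->
  continuous (fun t : R => Num.max t 0 `^ r).
Proof.
rewrite le_eqVlt => /predU1P[<-|r0] t.
  by rewrite (_ : (fun _ => _) = cst 1); [exact: cvg_cst|apply/funext => x; rewrite powRr0].
have [t0|t0] := ltP 0 t.
  apply: (@cvg_trans _ ((fun x => x `^ r) @ t)).
    apply: near_eq_cvg; near=> x; rewrite max_l// ltW//.
    by near: x; exact: lt_nbhsr.
  rewrite /= max_l; last exact: ltW.
  have /derivable1_diffP/differentiable_continuous : derivable (@powR R ^~ r) t 1.
    by apply: derivable_powR; rewrite in_itv/= t0.
  exact.
apply/cvgrPdist_lt => e e0; rewrite max_r// powR0 ?gt_eqF//.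
(* Below the radius e^(1/r) the r-th power stays below e. *)
have d0 : 0 < e `^ r^-1 by exact: powR_gt0.
near=> x; rewrite sub0r normrN ger0_norm ?powR_ge0//.
have de : e = (e `^ r^-1) `^ r by rewrite -powRrM mulVf ?gt_eqF// powRr1// ltW.
rewrite [ltRHS]de gt0_ltr_powR// ?nnegrE ?le_max ?lexx ?orbT//; first exact: ltW.
rewrite gt_max d0 andbT.
by near: x; apply: lt_nbhsl; exact: le_lt_trans t0 d0.
Unshelve. all: by end_near. Qed.

Definition power_sum n (r : R) (K L : set 'rV[R]_n) : set 'rV[R]_n :=
  [set z | exists x y t, [/\ K x, L y, 0 <= t <= 1 &
         z = ((1 - t) `^ r) *: x + (t `^ r) *: y]].

Lemma compact_power_sum n (r : R) (K L : set 'rV[R]_n) : 0 <= r ->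
  compact K -> compact L -> compact (power_sum r K L).
Proof.
move=> r0 cK cL.
pose g (t : R) := Num.max t 0 `^ r.
have cg : continuous g by exact: continuous_powR_max.
pose f (z : R * ('rV[R]_n * 'rV[R]_n)) := g (1 - z.1) *: z.2.1 + g z.1 *: z.2.2.
have -> : power_sum r K L = f @` (`[0, 1]%classic `*` (K `*` L)).
  apply/seteqP; split => [z [x [y [t [Kx Ly t01 ->]]]]|z [[t [x y]]]].
    exists (t, (x, y)) => //=; rewrite /f/= /g.
    by case/andP: t01 => t0 t1; rewrite !max_l// subr_ge0.
  move=> [/= t01 [Kx Ly]] <-; exists x, y, t; split => //; rewrite /f/= /g.
  by move: t01; rewrite in_itv/= => /andP[t0 t1]; rewrite !max_l// subr_ge0.
apply: continuous_compact; last first.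
  apply: compact_setX; first exact: segment_compact.
  exact: compact_setX.
apply: continuous_subspaceT.
pose X := (R * ('rV[R]_n * 'rV[R]_n))%type.
have h1 : continuous (fun z : X => z.1) by move=> z; exact: cvg_fst.
have h2 : continuous (fun z : X => z.2) by move=> z; exact: cvg_snd.
have h3 : continuous (fun z : X => z.2.1).
  by move=> z; apply: (@continuous_comp _ _ _ _ fst); [exact: h2|exact: cvg_fst].
have h4 : continuous (fun z : X => z.2.2).
  by move=> z; apply: (@continuous_comp _ _ _ _ snd); [exact: h2|exact: cvg_snd].
have h5 : continuous (fun z : X => g z.1).
  by move=> z; apply: (@continuous_comp _ _ _ _ g); [exact: h1|exact: cg].
have h6 : continuous (fun z : X => g (1 - z.1)).
  move=> z; apply: (@continuous_comp _ _ _ (fun z : X => 1 - z.1) g); last exact: cg.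
  by apply: cvgB; [exact: cvg_cst|exact: h1].
move=> z; apply: cvgD; apply: cvgZ; [exact: h6|exact: h3|exact: h5|exact: h4].
Qed.

End Topology.

(** * Volume of sets of row vectors and comparison along lines *)

Section Volume.
Context {R : realType}.
Notation T := (measurableTypeR R).
Notation lambda := (@lebesgue_measure R).

Definition cmul n (d x : 'rV[R]_n) : 'rV[R]_n := \row_i (d 0 i * x 0 i).

Lemma volumeE n (A : set 'rV[R]_n) : volume A = lebesgueRn R n (rowset A).
Proof. by []. Qed.

Lemma le_volume n (A B : set 'rV[R]_n) : measurable (rowset A) ->
  measurable (rowset B) -> A `<=` B -> (volume A <= volume B)%E.
Proof.
by move=> mA mB AB; apply: le_measure; rewrite ?inE// => t; exact: AB.
Qed.

Lemma rowset_cmul n (d : 'rV[R]_n) (A : set 'rV[R]_n) :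
  rowset [set x | A (cmul d x)] = tscale (fun i => d 0 i) @^-1` rowset A.
Proof.
apply/seteqP; split => t; rewrite /rowset/=; congr (A _); apply/rowP => i;
  by rewrite !mxE tnth_mktuple.
Qed.

Lemma measurable_rowset_cmul n (d : 'rV[R]_n) (A : set 'rV[R]_n) :
  measurable (rowset A) -> measurable (rowset [set x | A (cmul d x)]).
Proof. by rewrite rowset_cmul; exact: measurable_preimage_tscale. Qed.

Lemma volume_cmul n (d : 'rV[R]_n) (A : set 'rV[R]_n) :
  (forall i, d 0 i != 0) -> measurable (rowset A) ->
  volume [set x | A (cmul d x)] = ((\prod_i `|d 0 i|^-1)%:E * volume A)%E.
Proof. by move=> d0 mA; rewrite !volumeE rowset_cmul lebesgueRn_scale. Qed.

Lemma measurable_hyperplane n (k : 'I_n) :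
  measurable (rowset [set z : 'rV[R]_n | z 0 k = 0]).
Proof.
apply: measurable_rowset_closed.
apply: (@closed_comp _ _ (fun x : 'rV[R]_n => x 0 k) [set 0]).
  by move=> x _; exact: coord_continuous.
exact: closed_eq.
Qed.

Lemma volume_hyperplane n (k : 'I_n) : volume [set x : 'rV[R]_n | x 0 k = 0] = 0%E.
Proof.
pose A (i : 'I_n) : set R := if i == k then [set 0] else setT.
rewrite (_ : [set _ | _] = [set x : 'rV_n | forall i, A i (x 0 i)]).
  rewrite volume_rect; last first.
    by move=> i; rewrite /A; case: ifP => // _; exact: measurable_set1.
  by rewrite (bigD1 k)//= {1}/A eqxx lebesgue_measure_set1 mul0e.
apply/seteqP; split => x /=.
  by move=> xk i; rewrite /A; case: ifPn => // /eqP ->.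
by move=> /(_ k); rewrite /A eqxx.
Qed.

Definition set_coord n (x : 'rV[R]_n) (k : 'I_n) (c : R) : 'rV[R]_n :=
  \row_i (if i == k then c else x 0 i).

Lemma le_volume_fibre n (k : 'I_n) (A B C : set 'rV[R]_n) :
  measurable (rowset A) -> measurable (rowset B) -> measurable (rowset C) ->
  (forall x, (lambda [set c | A (set_coord x k c)] <=
     lambda [set c | B (set_coord x k c)] + lambda [set c | C (set_coord x k c)])%E) ->
  (volume A <= volume B + volume C)%E.
Proof.
move=> mA mB mC H; apply: (le_lebesgueRn_fibre (k := k)) => // t.
have E (D : set 'rV[R]_n) : [set c | rowset D (tuple_set_coord t k c)] =
    [set c | D (set_coord (\row_i tnth t i) k c)].
  apply/seteqP; split => c; rewrite /rowset/=; congr (D _); apply/rowP => i;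
  by rewrite !mxE tnth_mktuple.
by rewrite !E.
Qed.

Lemma measurable_set_coord n (k : 'I_n) (x : 'rV[R]_n) (A : set 'rV[R]_n) :
  measurable (rowset A) -> measurable [set c : T | A (set_coord x k c)].
Proof.
move=> mA; rewrite (_ : [set _ | _] =
  (fun c : T => [tuple if i == k then c else x 0 i | i < n]) @^-1` rowset A).
  rewrite -[X in measurable X]setTI.
  apply: measurable_tuple_ord => // i; case: eqP => _; last exact: measurable_cst.
  exact: measurable_id.
by apply/seteqP; split => c; rewrite /rowset/=; congr (A _); apply/rowP => i;
  rewrite !mxE tnth_mktuple.
Qed.

(** On either side of 0, each c in A comes with intervals of lengths |p| and |q| at 0 inside B and
    C. Hence |c| <= |p| + |q| is at most the total length l of B and C on that side, and one
    interval of length l covers A there. Letting p and q depend on c avoids suprema. *)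
Lemma le_lebesgue_measure_sum (A B C : set T) :
  measurable A -> measurable B -> measurable C ->
  (forall c, A c -> 0 <= c -> exists p q, [/\ 0 <= p, 0 <= q, c <= p + q,
     forall s, 0 <= s <= p -> B s & forall s, 0 <= s <= q -> C s]) ->
  (forall c, A c -> c <= 0 -> exists p q, [/\ p <= 0, q <= 0, p + q <= c,
     forall s, p <= s <= 0 -> B s & forall s, q <= s <= 0 -> C s]) ->
  (lambda A <= lambda B + lambda C)%E.
Proof.
move=> mA mB mC Hp Hm.
pose P : set T := `[0, +oo[%classic.
have mP : measurable P by exact: measurable_itv.
have notP (s : R) : s < 0 -> ~ P s.
  by rewrite ltNge => /negP s0; rewrite /P/= in_itv/= andbT.
have split3 D : measurable D -> (lambda D = lambda (D `\` P) + lambda (D `&` P))%E.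
  by move=> mD; exact: measureDI.
have step (A' B' C' : set T) (I : R -> set T) :
    measurable A' -> measurable B' -> measurable C' ->
    (forall l, measurable (I l) /\ (0 <= l -> lambda (I l) = l%:E)) ->
    (forall c, A' c -> exists p q, [/\ 0 <= p, 0 <= q, I p `<=` B', I q `<=` C' &
      forall l, p + q <= l -> I l c]) ->
    (lambda A' <= lambda B' + lambda C')%E.
  move=> mA' mB' mC' mI H.
  have [|loo] := eqVneq (lambda B' + lambda C')%E +oo%E; first by move=> ->; rewrite leey.
  have lfin : (lambda B' + lambda C')%E \is a fin_num.
    by rewrite ge0_fin_numE ?adde_ge0// lt_neqAle loo leey.
  rewrite -(fineK lfin).
  have [mIl lE] := mI (fine (lambda B' + lambda C')).
  have l0 : 0 <= fine (lambda B' + lambda C')%E by rewrite fine_ge0// adde_ge0.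
  rewrite -(lE l0); apply: le_measure; rewrite ?inE//.
  move=> c /H[p [q [p0 q0 pB qC]]]; apply.
  rewrite -lee_fin (fineK lfin) EFinD.
  have [mIp <-//] := mI p; have [mIq <-//] := mI q.
  by rewrite leeD// le_measure// inE.
rewrite (split3 A)// (split3 B)// (split3 C)// addeACA.
apply: leeD.
(* Half-open, since 0 is counted in the nonnegative part P. *)
- apply: (step _ _ _ (fun l => `[- l, 0[%classic)).
  + exact: measurableD.
  + exact: measurableD.
  + exact: measurableD.
  + move=> l; split; first exact: measurable_itv.
    rewrite lebesgue_measure_itv/= lte_fin oppr_lt0 => l0.
    case: ltP => l0'; last by congr _%:E; apply/eqP; rewrite eq_le l0 l0'.
    by rewrite -EFinB sub0r opprK.
  + move=> c [Ac nPc]; have c0 : c < 0.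
      rewrite ltNge; apply/negP => c0; apply: nPc.
      by rewrite /P/= in_itv/= andbT.
    have [p [q [p0 q0 cpq pB qC]]] := Hm _ Ac (ltW c0).
    exists (- p), (- q); rewrite !oppr_ge0; split => //.
    * move=> s/=; rewrite !in_itv/= opprK => /andP[ps s0]; split.
        by apply: pB; rewrite ps ltW.
      exact: notP.
    * move=> s/=; rewrite !in_itv/= opprK => /andP[ps s0]; split.
        by apply: qC; rewrite ps ltW.
      exact: notP.
    * by move=> l pql; rewrite /= in_itv/= c0 andbT; lra.
- apply: (step _ _ _ (fun l => `[0, l]%classic)).
  + exact: measurableI.
  + exact: measurableI.
  + exact: measurableI.
  + move=> l; split; first exact: measurable_itv.
    rewrite lebesgue_measure_itv/= lte_fin => l0.
    case: ltP => l0'; last by congr _%:E; apply/eqP; rewrite eq_le l0 l0'.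
    by rewrite sube0.
  + move=> c [Ac]; rewrite /P/= in_itv/= andbT => c0.
    have [p [q [p0 q0 cpq pB qC]]] := Hp _ Ac c0.
    exists p, q; split => //.
    * move=> s/=; rewrite in_itv/= => /andP[ps s0]; split; last by rewrite /P/= in_itv/= ps.
      by apply: pB; rewrite ps s0.
    * move=> s/=; rewrite in_itv/= => /andP[ps s0]; split; last by rewrite /P/= in_itv/= ps.
      by apply: qC; rewrite ps s0.
    * by move=> l pql; rewrite /= in_itv/= c0 /=; lra.
Qed.

End Volume.

(** * Reduction to one orthant *)

Section ShrinkBody.
Context {R : realType} (n : nat).
Notation T := (measurableTypeR R).
Notation lambda := (@lebesgue_measure R).
Implicit Types (K : set 'rV[R]_n) (x y : 'rV[R]_n).

Definition shrinkable K := forall x (d : 'rV[R]_n), K x -> (forall i, 0 <= d 0 i <= 1) ->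
  K (cmul d x).

Definition shrink_body K := [/\ compact K,
  forall x y t, K x -> K y -> 0 <= t <= 1 -> K ((1 - t) *: x + t *: y) &
  shrinkable K].

Lemma shrinkable_set_coord K x k (c : R) : shrinkable K -> K x ->
  (0 <= c <= x 0 k) \/ (x 0 k <= c <= 0) \/ c = 0 -> K (set_coord x k c).
Proof.
move=> sK Kx H.
(* If x 0 k = 0 then c = 0, and the factor c / 0 is 0, still in [0, 1]. *)
rewrite (_ : set_coord x k c = cmul (\row_i (if i == k then c / x 0 k else 1)) x).
  apply: sK => // i; rewrite mxE; case: ifP => _; last by rewrite lexx ler01.
  case: H => [/andP[c0 cx]|[/andP[xc c0]|->]]; last by rewrite mul0r lexx ler01.
    have [x0|x0] := eqVneq (x 0 k) 0; first by rewrite x0 invr0 mulr0 lexx ler01.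
    have xp : 0 < x 0 k by rewrite lt_neqAle eq_sym x0 (le_trans c0).
    by rewrite divr_ge0 ?(ltW xp)// ler_pdivrMr// mul1r.
  have [x0|x0] := eqVneq (x 0 k) 0; first by rewrite x0 invr0 mulr0 lexx ler01.
  have xp : x 0 k < 0 by rewrite lt_neqAle x0 (le_trans xc).
  by rewrite mulr_le0 ?invr_le0 ?(ltW xp)// ler_ndivrMr// mul1r.
apply/rowP => i; rewrite !mxE; case: eqP => [->|_]; last by rewrite mul1r.
have [x0|x0] := eqVneq (x 0 k) 0; last by rewrite divfK.
by rewrite x0 mulr0; case: H; rewrite x0; lra.
Qed.

Lemma compact_neg_set K : compact K -> compact (neg_set K).
Proof.
move=> cK; apply: continuous_compact => //; apply: continuous_subspaceT.
exact: opp_continuous.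
Qed.

Definition half K (k : 'I_n) (e : R) := K `&` [set x | 0 <= e * x 0 k].

Lemma closed_half (k : 'I_n) (e : R) : closed [set x : 'rV[R]_n | 0 <= e * x 0 k].
Proof.
apply: (@closed_comp _ _ (fun x : 'rV[R]_n => e * x 0 k) [set c : R | 0 <= c]).
  move=> x _; apply: (@continuous_comp _ _ _ (fun x : 'rV[R]_n => x 0 k) ( *%R e)).
    exact: coord_continuous.
  exact: mulrl_continuous.
exact: closed_ge.
Qed.

Lemma shrink_body_half K k e : shrink_body K -> shrink_body (half K k e).
Proof.
case=> cK vK sK; split.
- by apply: compact_closedI => //; exact: closed_half.
- move=> x y t [Kx /= x0] [Ky /= y0] t01; split; first exact: vK.
  case/andP: t01 => t0 t1.
  rewrite /= !mxE mulrDr !(mulrCA e) addr_ge0// mulr_ge0//.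
  by rewrite subr_ge0.
- move=> x d [Kx /= x0] d01; split; first exact: sK.
  by rewrite /= mxE mulrCA mulr_ge0//; case/andP: (d01 k).
Qed.

Lemma measurable_rowset_power_sum_neg (r : R) K : 0 <= r -> shrink_body K ->
  measurable (rowset (power_sum r K (neg_set K))).
Proof.
move=> r0 [cK _ _]; apply: measurable_rowset_compact; apply: compact_power_sum => //.
exact: compact_neg_set.
Qed.

(* On a line in direction k through z, the nonnegative part of the sum is [0, sup (a f + b g)]
   over the admissible pairs, while the two half-bodies contribute [0, sup a f] and [0, sup b g];
   likewise on the negative side. *)
Lemma volume_power_sum_neg_half (r : R) K k : 0 <= r -> shrink_body K ->
  (volume (power_sum r K (neg_set K)) <=
   volume (power_sum r (half K k 1) (neg_set (half K k 1))) +
   volume (power_sum r (half K k (-1)) (neg_set (half K k (-1)))))%E.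
Proof.
move=> r0 gK; have [cK vK sK] := gK.
apply: (le_volume_fibre (k := k)); rewrite ?measurable_rowset_power_sum_neg//;
  try by apply: measurable_rowset_power_sum_neg => //; exact: shrink_body_half.
(* Only the k-th coordinates of u and v are changed, to y and z. The last two conditions put y
   between 0 and u_k and z between 0 and v_k, so the new points stay in K; the sign conditions put
   them in the half of sign e. *)
have mem e u v t x (s y z : R) : K u -> K v -> 0 <= t <= 1 ->
    (forall i, i != k -> x 0 i = (1 - t) `^ r * u 0 i - t `^ r * v 0 i) ->
    0 <= e * y -> 0 <= e * z -> s = (1 - t) `^ r * y - t `^ r * z ->
    (0 <= y <= Num.max (u 0 k) 0) \/ (0 <= - y <= Num.max (- u 0 k) 0) ->
    (0 <= z <= Num.max (v 0 k) 0) \/ (0 <= - z <= Num.max (- v 0 k) 0) ->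
    power_sum r (half K k e) (neg_set (half K k e)) (set_coord x k s).
  move=> Ku Kv t01 E ey ez sE.
  have cases (w : 'rV[R]_n) (y' : R) : (0 <= y' <= Num.max (w 0 k) 0) \/
      (0 <= - y' <= Num.max (- w 0 k) 0) ->
      (0 <= y' <= w 0 k) \/ (w 0 k <= y' <= 0) \/ y' = 0.
    by rewrite !le_max; have [|] := ltP (w 0 k) 0 => w0; case=> H; lra.
  move=> /cases /(shrinkable_set_coord sK Ku) Ky /cases /(shrinkable_set_coord sK Kv) Kz.
  exists (set_coord u k y), (- set_coord v k z), t; split => //.
  + by split => //=; rewrite mxE eqxx.
  + by exists (set_coord v k z) => //; split => //=; rewrite mxE eqxx.
  + apply/rowP => i; rewrite !mxE mulrN; case: eqP => [//|/eqP ik].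
    exact: E.
(* A point of [0, a m] is a times a point of [0, m], also for a = 0. *)
have dvd (a s m : R) : 0 <= a -> 0 <= s <= a * m -> 0 <= m ->
    exists2 y, s = a * y & 0 <= y <= m.
  rewrite le_eqVlt => /predU1P[<-|a0].
    by rewrite mul0r => s0 m0; exists 0; [lra|rewrite lexx].
  move=> s0 m0; exists (s / a); first by rewrite mulrC divfK ?gt_eqF.
  by rewrite divr_ge0 ?ler_pdivrMr// 1?mulrC; case/andP: s0 => // _ _; exact: ltW.
have max0 (y : R) : 0 <= Num.max y 0 by rewrite le_max lexx orbT.
have maxl (y : R) : y <= Num.max y 0 by rewrite le_max lexx.
have Max0 (y : R) : (0 <= 0 <= Num.max y 0) by rewrite lexx max0.
move=> x; apply: le_lebesgue_measure_sum.
- by apply: measurable_set_coord; exact: measurable_rowset_power_sum_neg.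
- by apply: measurable_set_coord; apply: measurable_rowset_power_sum_neg => //; exact: shrink_body_half.
- by apply: measurable_set_coord; apply: measurable_rowset_power_sum_neg => //; exact: shrink_body_half.
- move=> c [u [_ [t [Ku [v Kv <-] t01 /rowP E]]]] c0.
  have Ei i : i != k -> x 0 i = (1 - t) `^ r * u 0 i - t `^ r * v 0 i.
    by move=> /negPf ik; have := E i; rewrite !mxE ik mulrN.
  have Ek : c = (1 - t) `^ r * u 0 k - t `^ r * v 0 k.
    by have := E k; rewrite !mxE eqxx mulrN.
  (* Bound both terms of c = a u_k - b v_k by their positive parts. The first is reached in the
     positive half with v_k set to 0, the second in the negative half with u_k set to 0. *)
  exists ((1 - t) `^ r * Num.max (u 0 k) 0), (t `^ r * Num.max (- v 0 k) 0).
  split; rewrite ?mulr_ge0 ?powR_ge0//.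
  + by rewrite Ek -mulrN lerD// ler_wpM2l// powR_ge0.
  + move=> s /(dvd _ _ _ (powR_ge0 _ _)) [//|y -> y0].
    apply: (mem _ _ _ _ _ _ y 0 Ku Kv t01 Ei); rewrite ?mulr0 ?subr0//; try by left.
    by rewrite mul1r; case/andP: y0.
  + move=> s /(dvd _ _ _ (powR_ge0 _ _)) [//|y -> y0].
    apply: (mem _ _ _ _ _ _ 0 (- y) Ku Kv t01 Ei); rewrite ?mulr0 ?sub0r//; try by left.
    * by rewrite mulN1r opprK; case/andP: y0.
    * by rewrite mulrN opprK.
    * by right; rewrite opprK.
- move=> c [u [_ [t [Ku [v Kv <-] t01 /rowP E]]]] c0.
  have Ei i : i != k -> x 0 i = (1 - t) `^ r * u 0 i - t `^ r * v 0 i.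
    by move=> /negPf ik; have := E i; rewrite !mxE ik mulrN.
  have Ek : c = (1 - t) `^ r * u 0 k - t `^ r * v 0 k.
    by have := E k; rewrite !mxE eqxx mulrN.
  (* For negative c the roles are exchanged: the positive half contributes through v, the negative
     half through u. *)
  exists (- (t `^ r * Num.max (v 0 k) 0)), (- ((1 - t) `^ r * Num.max (- u 0 k) 0)).
  split; rewrite ?oppr_le0 ?mulr_ge0 ?powR_ge0//.
  + rewrite Ek addrC lerD//; last by rewrite lerN2 ler_wpM2l// powR_ge0.
    by rewrite lerNl -mulrN ler_wpM2l// powR_ge0.
  + move=> s; rewrite lerNl -oppr_ge0 andbC.
    move=> /(dvd _ _ _ (powR_ge0 _ _)) [//|y sy y0].
    apply: (mem _ _ _ _ _ _ 0 y Ku Kv t01 Ei); rewrite ?mulr0 ?sub0r//; try by left.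
    * by rewrite mul1r; case/andP: y0.
    * by rewrite -sy opprK.
  + move=> s; rewrite lerNl -oppr_ge0 andbC.
    move=> /(dvd _ _ _ (powR_ge0 _ _)) [//|y sy y0].
    apply: (mem _ _ _ _ _ _ (- y) 0 Ku Kv t01 Ei); rewrite ?mulr0 ?subr0//; try by left.
    * by rewrite mulN1r opprK; case/andP: y0.
    * by rewrite mulrN -sy opprK.
    * by right; rewrite opprK.
Qed.

(** The halves overlap only in the null hyperplane x_k = 0. *)
Lemma volume_half K k : shrink_body K ->
  (volume (half K k 1) + volume (half K k (-1)) <= volume K)%E.
Proof.
move=> gK; have [cK _ _] := gK.
have mK e : measurable (rowset (half K k e)).
  by apply: measurable_rowset_compact; case: (shrink_body_half k e gK).
have mK' := measurable_rowset_compact cK.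
pose H := [set x : 'rV[R]_n | x 0 k = 0].
have mH : measurable (rowset H) by exact: measurable_hyperplane.
rewrite !volumeE (measureDI _ mK' (mK 1)) addeC.
apply: leeD; last first.
  by apply: le_measure; rewrite ?inE//; [exact: measurableI|move=> t /= Kt; split => //; case: Kt].
have mKD : measurable (rowset K `\` rowset (half K k 1)) by exact: measurableD.
have H0 : lebesgueRn R n (rowset H) = 0%E by exact: volume_hyperplane.
apply: le_trans (_ : (_ <= lebesgueRn R n
    (rowset K `\` rowset (half K k 1) `|` rowset H))%E) _; last first.
  by rewrite (measureU0 mKD mH H0).
apply: le_measure; rewrite ?inE//; first exact: measurableU.
move=> t [Kt t0]; pose y : 'rV[R]_n := \row_i tnth t i.
have {}t0 : 0 <= -1 * y 0 k by exact: t0.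
have [t00|t00] := eqVneq (y 0 k) 0; first by right.
left; split => //= -[_ t1]; have {}t1 : 0 <= 1 * y 0 k by exact: t1.
by move/eqP: t00; apply; lra.
Qed.

Lemma volume_power_sum_neg_orthant (r c : R) : 0 <= r -> 0 <= c ->
  (forall K, shrink_body K ->
     (exists2 d : 'I_n -> R, (forall i, d i = 1 \/ d i = -1) &
       forall x, K x -> forall i, 0 <= d i * x 0 i) ->
     (volume (power_sum r K (neg_set K)) <= c%:E * volume K)%E) ->
  forall K, shrink_body K -> (volume (power_sum r K (neg_set K)) <= c%:E * volume K)%E.
Proof.
move=> r0 c0 H.
(* Induction on the number m of leading coordinates whose sign is still free; cutting along
   coordinate m - 1 fixes one more. *)
suff Q (m : nat) K : shrink_body K -> forall d : 'I_n -> R,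
    (forall i, d i = 1 \/ d i = -1) ->
    (forall x, K x -> forall i : 'I_n, (m <= i)%N -> 0 <= d i * x 0 i) ->
    (volume (power_sum r K (neg_set K)) <= c%:E * volume K)%E.
  move=> K gK; apply: (Q n K gK (fun=> 1)) => [i|x _ i]; first by left.
  by rewrite leqNgt ltn_ord.
elim: m K => [|m IHm] K gK d d1 Kd.
  by apply: H => //; exists d => // x Kx i; exact: Kd.
have [nm|mn] := leqP n m.
  apply: (IHm K gK d) => // x Kx i mi.
  by have := leq_trans nm mi; rewrite leqNgt ltn_ord.
pose k := Ordinal mn.
have step e : e = 1 \/ e = -1 ->
    (volume (power_sum r (half K k e) (neg_set (half K k e))) <= c%:E * volume (half K k e))%E.
  move=> e1; apply: (IHm _ (shrink_body_half k e gK) (fun i => if i == k then e else d i)).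
    by move=> i; case: ifP.
  move=> x [Kx /= x0] i mi; case: eqP => [->//|/eqP ik].
  by apply: Kd => //; rewrite ltn_neqAle mi andbT eq_sym -(inj_eq val_inj) in ik *.
apply: (le_trans (volume_power_sum_neg_half k r0 gK)).
apply: (@le_trans _ _ (c%:E * (volume (half K k 1) + volume (half K k (-1))))%E).
  by rewrite ge0_muleDr//; apply: leeD; apply: step; [left|right].
by apply: lee_wpmul2l; [rewrite lee_fin|exact: volume_half].
Qed.

End ShrinkBody.

(** * Exponential weights and the Gamma function *)

Section ExpWeight.
Context {R : realType}.
Notation T := (measurableTypeR R).
Notation lambda := (@lebesgue_measure R).

(** Exponential density, with the indicator built in so that every integral below runs over the
    whole line, as in Tonelli's theorem on the product. *)
Definition exp_weight (s : R) : R := \1_`]0, +oo[%classic s * expR (- s).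

Lemma exp_weight_ge0 s : 0 <= exp_weight s.
Proof. by rewrite mulr_ge0 ?expR_ge0// indicE. Qed.

Lemma exp_weight_gt0E s : 0 < s -> exp_weight s = expR (- s).
Proof.
by move=> s0; rewrite /exp_weight indicE mem_set ?mul1r//= in_itv/= s0.
Qed.

Lemma exp_weight_le0E s : s <= 0 -> exp_weight s = 0.
Proof.
by move=> s0; rewrite /exp_weight indicE memNset ?mul0r//= in_itv/= andbT; apply/negP; rewrite -leNgt.
Qed.

Lemma measurable_exp_weight : measurable_fun [set: T] exp_weight.
Proof.
apply: measurable_funM; first by apply: measurable_indic; exact: measurable_itv.
apply: measurableT_comp; first exact: measurable_expR.
exact: oppr_measurable.
Qed.

Definition wexp (U : set T) : \bar R := (\int[lambda]_s (exp_weight s * \1_U s)%:E)%E.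

Lemma wexp_ge0 U : (0 <= wexp U)%E.
Proof. by apply: integral_ge0 => s _; rewrite lee_fin mulr_ge0 ?exp_weight_ge0// indicE. Qed.

Lemma measurable_exp_weight_indic U : measurable U ->
  measurable_fun [set: T] (fun s => (exp_weight s * \1_U s)%:E).
Proof.
move=> mU; apply/measurable_EFinP; apply: measurable_funM; first exact: measurable_exp_weight.
exact: measurable_indic.
Qed.

Lemma le_wexp U V : measurable U -> measurable V -> U `<=` V ->
  (wexp U <= wexp V)%E.
Proof.
move=> mU mV UV; apply: ge0_le_integral => //.
- by move=> s _; rewrite lee_fin mulr_ge0 ?exp_weight_ge0// indicE.
- exact: measurable_exp_weight_indic.
- exact: measurable_exp_weight_indic.
- move=> s _; rewrite lee_fin ler_wpM2l ?exp_weight_ge0// !indicE.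
  by have [sU|//] := boolP (s \in U); rewrite mem_set//; exact/UV/set_mem.
Qed.

Lemma integral_expRN (h : R) :
  (\int[lambda]_(s in `[h, +oo[) (expR (- s))%:E = (expR (- h))%:E)%E.
Proof.
have cE : continuous (fun x : R => expR (- x)).
  move=> x; apply: (@continuous_comp _ _ _ -%R expR); last exact: continuous_expR.
  exact: opp_continuous.
rewrite (@ge0_continuous_FTC2y _ _ (fun x => - expR (- x)) _ 0)//.
- by rewrite sub0e -EFinN opprK.
- exact: continuous_subspaceT.
- rewrite -oppr0; apply: cvgN; exact: cvgr_expR.
- by apply: cvg_at_right_filter; apply: cvgN; exact: cE.
- move=> x _; rewrite (@derive1_comp _ (fun y => expR (- y)) -%R)//.
  rewrite derive1N// derive1_id mulN1r derive1_comp// derive1E.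
  have /funeqP -> := @derive_expR R.
  by rewrite derive1N// derive1_id mulrN1 opprK.
Qed.

Lemma wexpE U : wexp U = (\int[lambda]_(s in U `&` `]0%R, +oo[) (expR (- s))%:E)%E.
Proof.
rewrite integral_mkcond; apply: eq_integral => s _; rewrite patchE.
rewrite /exp_weight !indicE in_setI mulrAC.
by case: (_ \in U); case: (_ \in _); rewrite /= ?(mul1r, mulr0, mul0r).
Qed.

Lemma wexp_cy (h : R) : 0 <= h -> wexp `[h, +oo[%classic = (expR (- h))%:E.
Proof.
move=> h0; rewrite -integral_expRN wexpE.
move: h0; rewrite le_eqVlt => /predU1P[<-|h0].
  rewrite setIidr; last by apply: subset_itvr; rewrite bnd_simp.
  rewrite integral_itv_obnd_cbnd//.
  apply/measurable_EFinP; apply: measurable_funTS.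
  by apply: measurableT_comp; [exact: measurable_expR|exact: oppr_measurable].
by rewrite setIidl//; apply: subset_itvr; rewrite bnd_simp.
Qed.

Lemma wexp_oy (h : R) : 0 <= h -> wexp `]h, +oo[%classic = (expR (- h))%:E.
Proof.
move=> h0; rewrite -integral_expRN wexpE setIidl; last first.
  by apply: subset_itvr; rewrite bnd_simp.
rewrite integral_itv_obnd_cbnd//.
apply/measurable_EFinP; apply: measurable_funTS.
by apply: measurableT_comp; [exact: measurable_expR|exact: oppr_measurable].
Qed.

Definition upset (U : set R) := forall s s', U s -> s <= s' -> U s'.

Lemma measurable_upset (U : set T) : upset U -> measurable U.
Proof.
move=> uU; apply: is_interval_measurable => x y Ux Uy z /andP[xz zy].
exact: uU Ux xz.
Qed.

Lemma wexp_upset (U : set T) : upset U -> U `<=` `]0, +oo[%classic -> U !=set0 ->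
  0 <= inf U /\ wexp U = (expR (- inf U))%:E.
Proof.
move=> uU U0 Un.
have lbU : lbound U 0 by move=> x /U0/=; rewrite in_itv/= andbT; exact: ltW.
have hlb : has_inf U by split => //; exists 0.
have i0 : 0 <= inf U by exact: lb_le_inf.
(* U lies between the open and the closed half-line starting at its infimum, and these have the same
   weight. *)
split => //; apply/eqP; rewrite eq_le -{1}(wexp_cy i0) -(wexp_oy i0).
have mU := measurable_upset uU.
apply/andP; split; apply: le_wexp => //; try exact: measurable_itv.
  by move=> s Us /=; rewrite in_itv/= andbT; apply: ge_inf => //; exists 0.
move=> s /=; rewrite in_itv/= andbT => /(inf_lt Un)[x Ux xs].
exact: uU Ux (ltW xs).
Qed.

Lemma wexp0 : wexp set0 = 0%E.
Proof. by rewrite /wexp integral0_eq// => s _; rewrite indic0 mulr0. Qed.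

(* For an up-set U of (0, oo), wexp U = exp (- inf U), and the infimum of a sum of sets is the sum
   of the infima. *)
Lemma wexp_sum (U U1 U2 : set T) : upset U -> upset U1 -> upset U2 ->
  U `<=` `]0, +oo[%classic -> U1 `<=` `]0, +oo[%classic -> U2 `<=` `]0, +oo[%classic ->
  (forall s1 s2, U1 s1 -> U2 s2 -> U (s1 + s2)) ->
  (forall s e, U s -> 0 < e -> exists s1 s2, [/\ U1 s1, U2 s2 & s1 + s2 <= s + e]) ->
  wexp U = (wexp U1 * wexp U2)%E.
Proof.
move=> uU uU1 uU2 p p1 p2 H1 H2.
(* The infimum formula is false for the empty set, whose weight is 0. If U is empty then so is U1 or
   U2; if not, the approximation property at e = 1 shows that neither is. *)
have [[u Uu]|/nonemptyPn U0] := pselect (U !=set0); last first.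
  rewrite U0 wexp0.
  have [[u1 U1u]|/nonemptyPn ->] := pselect (U1 !=set0); last by rewrite wexp0 mul0e.
  have [[u2 U2u]|/nonemptyPn ->] := pselect (U2 !=set0); last by rewrite wexp0 mule0.
  by have := H1 _ _ U1u U2u; rewrite U0.
have [v1 [v2 [Uv1 Uv2 _]]] := H2 _ _ Uu ltr01.
have Un : U !=set0 by exists u.
have Un1 : U1 !=set0 by exists v1.
have Un2 : U2 !=set0 by exists v2.
have lb V : V `<=` `]0, +oo[%classic -> V !=set0 -> has_inf (V : set R).
  move=> V0 Vn; split => //; exists 0 => x /V0/=.
  by rewrite in_itv/= andbT; exact: ltW.
have [_ ->] := wexp_upset uU p Un.
have [_ ->] := wexp_upset uU1 p1 Un1.
have [_ ->] := wexp_upset uU2 p2 Un2.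
rewrite -EFinM -expRD -opprD; congr (expR (- _))%:E.
have hU := lb _ p Un; have hU1 := lb _ p1 Un1; have hU2 := lb _ p2 Un2.
apply/eqP; rewrite eq_le; apply/andP; split.
  rewrite -lerBlDr; apply: lb_le_inf => // s1 U1s.
  rewrite lerBlDr -lerBlDl; apply: lb_le_inf => // s2 U2s.
  by rewrite lerBlDl; apply: ge_inf; [exact: hU.2|exact: H1].
apply: lb_le_inf => // s Us; apply/ler_addgt0Pr => e e0.
have [s1 [s2 [U1s U2s ]]] := H2 _ _ Us e0; apply: le_trans.
by apply: lerD; apply: ge_inf => //; [exact: hU1.2|exact: hU2.2].
Qed.

Section Tonelli.
Context d (X : measurableType d) (m : {sigma_finite_measure set X -> \bar R}).
Variable G : set (T * X).
Hypothesis mG : measurable G.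

Lemma measurable_wexp_section :
  measurable_fun setT (fun z => wexp [set s | G (s, z)]).
Proof.
pose f (sz : T * X) := (exp_weight sz.1 * \1_G sz)%:E.
have mf : measurable_fun setT f.
  apply/measurable_EFinP; apply: measurable_funM; last exact: measurable_indic.
  by apply: measurableT_comp; [exact: measurable_exp_weight|exact: measurable_fst].
have f0 sz : (0 <= f sz)%E by rewrite lee_fin mulr_ge0 ?exp_weight_ge0// indicE.
exact: (measurable_fun_fubini_tonelli_G (m1 := lambda) f mf f0).
Qed.

(** Exchanges slices of G at fixed s with the exponential weight of its fibres over z. The factor
    phi allows a second use inside the first, when a product of two weights is integrated. *)
Lemma tonelli_exp_weight (phi : X -> \bar R) : measurable_fun setT phi ->
  (forall z, 0 <= phi z)%E ->
  (\int[lambda]_s ((exp_weight s)%:E * \int[m]_z ((\1_G (s, z))%:E * phi z)) =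
   \int[m]_z (wexp [set s | G (s, z)] * phi z))%E.
Proof.
move=> mphi phi0.
have mG1 (s : T) : measurable_fun setT (fun z : X => (\1_G (s, z) : R)%:E).
  apply/measurable_EFinP; apply: (measurableT_comp (measurable_indic mG)).
  exact: pair1_measurable.
have mG2 (z : X) : measurable_fun setT (fun s : T => (\1_G (s, z) : R)%:E).
  apply/measurable_EFinP; apply: (measurableT_comp (measurable_indic mG)).
  exact: pair2_measurable.
pose f (sz : T * X) := ((exp_weight sz.1)%:E * ((\1_G sz)%:E * phi sz.2))%E.
have mf : measurable_fun setT f.
  apply: emeasurable_funM.
    apply/measurable_EFinP; apply: measurableT_comp; first exact: measurable_exp_weight.
    exact: measurable_fst.
  apply: emeasurable_funM; first by apply/measurable_EFinP; exact: measurable_indic.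
  by apply: measurableT_comp => //; exact: measurable_snd.
have f0 sz : (0 <= f sz)%E.
  by rewrite mule_ge0 ?lee_fin ?exp_weight_ge0// mule_ge0// lee_fin indicE.
transitivity (\int[lambda]_s \int[m]_z f (s, z))%E.
  apply: eq_integral => s _; rewrite -ge0_integralZl//.
  - exact: emeasurable_funM.
  - by move=> z _; rewrite mule_ge0// lee_fin indicE.
  - by rewrite lee_fin exp_weight_ge0.
rewrite fubini_tonelli//; apply: eq_integral => z _.
rewrite /wexp -ge0_integralZr//.
- by apply: eq_integral => s _; rewrite /f/= muleA EFinM.
- apply: measurable_exp_weight_indic.
  rewrite -[X in measurable X]setTI.
  exact: (pair2_measurable z measurableT mG).
- by move=> s _; rewrite lee_fin mulr_ge0 ?exp_weight_ge0// indicE.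
Qed.

End Tonelli.

Lemma integral_expr (m : nat) (t : R) : 0 <= t ->
  (\int[lambda]_(u in `]0%R, t]) (m.+1%:R * u ^+ m)%:E = (t ^+ m.+1)%:E)%E.
Proof.
move=> t0; have mf (D : set T) : measurable_fun D (fun u : R => (m.+1%:R * u ^+ m)%:E).
  by apply/measurable_EFinP; apply: measurable_funM => //.
rewrite integral_itv_obnd_cbnd; last exact: mf.
move: t0; rewrite le_eqVlt => /predU1P[<-|t0].
  by rewrite set_itv1 integral_set1 expr0n.
rewrite (@continuous_FTC2 _ _ (fun u => u ^+ m.+1)) ?expr0n ?sube0//.
- apply: continuous_subspaceT => x.
  by apply: cvgM; [exact: cvg_cst|exact: exprn_continuous].
- split; first by move=> x _; exact: exprn_derivable.
  + exact/cvg_at_right_filter/exprn_continuous.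
  + exact/cvg_at_left_filter/exprn_continuous.
- by move=> x _; rewrite derive1E exp_derive scaler1 /=.
Qed.

(** Tonelli on 0 < u <= s in place of integration by parts: s^(m+1) is the integral of (m+1) u^m
    over ]0, s], and exp(-s) integrates to exp(-u) over [u, oo[. *)
Lemma integral_expr_exp_weight (m : nat) :
  (\int[lambda]_s (`|s| ^+ m * exp_weight s)%:E = (m`!%:R)%:E)%E.
Proof.
elim: m => [|m IHm].
  transitivity (wexp `]0, +oo[%classic); last by rewrite wexp_oy// oppr0 expR0 fact0.
  apply: eq_integral => s _; rewrite expr0 mul1r indicE.
  have [s0|s0] := leP s 0; first by rewrite exp_weight_le0E// mul0r.
  by rewrite mem_set ?mulr1//= in_itv/= s0.
pose G : set (T * T) := [set su | 0 < su.2 <= su.1].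
have mG : measurable G.
  rewrite (_ : G = (snd @^-1` `]0, +oo[%classic) `&`
      ((fun su : T * T => su.1 - su.2) @^-1` `[0, +oo[%classic)).
    apply: measurableI; rewrite -[X in measurable X]setTI.
      by apply: measurable_snd => //; exact: measurable_itv.
    by apply: measurable_funB => //; exact: measurable_itv.
  apply/seteqP; split => -[s u]; rewrite /G/= !in_itv/= !andbT subr_ge0.
    by move/andP.
  by move=> [-> ->].
pose phi (u : T) := (m.+1%:R * `|u| ^+ m)%:E.
have mphi : measurable_fun setT phi.
  apply/measurable_EFinP; apply: measurable_funM => //.
  apply: measurable_funX; exact: normr_measurable.
have phi0 u : (0 <= phi u)%E by rewrite lee_fin mulr_ge0.
have := @tonelli_exp_weight _ T lambda G mG phi mphi phi0.
rewrite (_ : (\int[lambda]_z (wexp [set s | G (s, z)] * phi z))%E =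
    (m.+1%:R%:E * (m`!%:R)%:E)%E); last first.
  rewrite -IHm -ge0_integralZl//; last first.
  - by move=> s _; rewrite lee_fin mulr_ge0 ?exp_weight_ge0.
  - apply/measurable_EFinP; apply: measurable_funM; last exact: measurable_exp_weight.
    apply: measurable_funX; exact: normr_measurable.
  apply: eq_integral => u _.
  have [u0|u0] := leP u 0.
    have -> : [set s | G (s, u)] = set0.
      by apply/seteqP; split => s //; rewrite /G/= ltNge u0.
    by rewrite exp_weight_le0E// mulr0 mule0 wexp0 mul0e.
  have -> : [set s | G (s, u)] = `[u, +oo[%classic.
    by apply/seteqP; split => s; rewrite /G/= in_itv/= u0 andbT.
  by rewrite wexp_cy ?ltW// exp_weight_gt0E// /phi -!EFinM mulrC mulrA.
rewrite -EFinM -natrM -factS => <-.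
apply: eq_integral => s _; have [s0|s0] := leP s 0.
  by rewrite exp_weight_le0E// mulr0 mul0e.
rewrite mulrC EFinM; congr (_ * _)%E.
rewrite (ger0_norm (ltW s0)) -integral_expr ?(ltW s0)// [LHS]integral_mkcond.
apply: eq_integral => u _; rewrite patchE indicE.
have -> : ((s, u) \in G) = (u \in (`]0, s]%classic : set T)).
  by apply/idP/idP => /set_mem/=; rewrite /G/= ?in_itv/= => su; apply/mem_set; rewrite /= ?in_itv.
case: ifPn => us; last by rewrite mul0e.
rewrite mul1e /phi ger0_norm//.
by move/set_mem: us; rewrite /= in_itv/= => /andP[/ltW].
Qed.

End ExpWeight.

(** * The Gamma function as a moment of the exponential weight *)

Section GammaFacts.
Context {R : realType}.
Notation T := (measurableTypeR R).
Notation lambda := (@lebesgue_measure R).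

Let measurable_powR_exp_weight (a : R) :
  measurable_fun setT (fun s : T => (s `^ a * exp_weight s)%:E).
Proof.
apply/measurable_EFinP; apply: measurable_funM; first exact: measurable_powR.
exact: measurable_exp_weight.
Qed.

Lemma integral_powR_exp_weight_lty (a : R) : 0 <= a ->
  (\int[lambda]_s (s `^ a * exp_weight s)%:E < +oo)%E.
Proof.
(* For a natural number m >= a, s^a is at most 1 + |s|^m; for s <= 0 the value of [powR] is 0 or
   1. *)
move=> a0; pose m := (Num.truncn a).+1.
have am : a <= m%:R by apply: ltW; exact: truncnS_gt.
apply: (@le_lt_trans _ _ (\int[lambda]_s ((`|s| ^+ 0 * exp_weight s)%:E + (`|s| ^+ m * exp_weight s)%:E))%E).
  have mD k : measurable_fun setT (fun s : T => (`|s| ^+ k * exp_weight s)%:E).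
    apply/measurable_EFinP; apply: measurable_funM; last exact: measurable_exp_weight.
    by apply: measurable_funX; exact: normr_measurable.
  apply: ge0_le_integral => //.
  - by move=> s _; rewrite lee_fin mulr_ge0 ?exp_weight_ge0// powR_ge0.
  - exact: emeasurable_funD.
  - move=> s _; rewrite -EFinD lee_fin -mulrDl ler_wpM2r ?exp_weight_ge0// expr0.
    have [s1|s1] := leP 1 s.
      rewrite ger0_norm ?(le_trans ler01)// -powR_mulrn ?(le_trans ler01)//.
      by rewrite ler_wpDl// ler_powR.
    rewrite ler_wpDr//.
    have [s0|s0] := leP s 0; last first.
      rewrite -(powRr0 s); apply: ger_powR => //.
      by rewrite s0 ltW.
    move: s0; rewrite le_eqVlt => /predU1P[->|s0]; last by rewrite lt0_powR1.
    by have [->|a00] := eqVneq a 0; [rewrite powRr0|rewrite powR0].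
rewrite ge0_integralD//; first by rewrite !integral_expr_exp_weight ltry.
all: try by move=> s _; rewrite lee_fin mulr_ge0 ?exp_weight_ge0.
all: apply/measurable_EFinP; apply: measurable_funM; last exact: measurable_exp_weight.
all: by apply: measurable_funX; exact: normr_measurable.
Qed.

(** [Gamma] is the finite part of an extended integral, so the equality rests on the finiteness just
    proved. *)
Lemma GammaE (a : R) : 0 <= a ->
  (\int[lambda]_s (s `^ a * exp_weight s)%:E)%E = (Gamma (a + 1))%:E.
Proof.
move=> a0; rewrite /Gamma /Rintegral addrK.
have <- : (\int[lambda]_s (s `^ a * exp_weight s)%:E =
    \int[lambda]_(t in `]0%R, +oo[) (t `^ a * expR (- t))%:E)%E.
  rewrite [RHS]integral_mkcond; apply: eq_integral => s _.
  rewrite patchE /exp_weight indicE; case: ifPn => _; rewrite ?mul1r// mul0r mulr0//.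
rewrite fineK// ge0_fin_numE; first exact: integral_powR_exp_weight_lty.
by apply: integral_ge0 => s _; rewrite lee_fin mulr_ge0 ?exp_weight_ge0// powR_ge0.
Qed.

Lemma Gamma_gt0 (a : R) : 0 <= a -> 0 < Gamma (a + 1).
Proof.
move=> a0; rewrite -lte_fin -GammaE//.
(* On [1, 2] the integrand is at least exp(-2), since s^a >= 1 there. *)
apply: (@lt_le_trans _ _ (\int[lambda]_s ((expR (- 2))%:E * (\1_(`[1%R, 2%R]%classic : set T) s)%:E))%E).
  rewrite ge0_integralZl//.
  - rewrite integral_indic; last exact: measurable_itv.
    rewrite setIT/= lebesgue_measure_itv/= lte_fin ltr1n.
    by rewrite -EFinB -EFinM lte_fin mulr_gt0 ?expR_gt0// subr_gt0 ltr1n.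
  - exact: measurableT.
  - by apply/measurable_EFinP; apply: measurable_indic; exact: measurable_itv.
apply: ge0_le_integral => //.
- apply: emeasurable_funM => //.
  by apply/measurable_EFinP; apply: measurable_indic; exact: measurable_itv.
- move=> s _; rewrite -EFinM lee_fin indicE.
  case: (boolP (s \in _)) => [|_]; last by rewrite mulr0 mulr_ge0 ?exp_weight_ge0// powR_ge0.
  move=> /set_mem/=; rewrite in_itv/= mulr1 => /andP[s1 s2].
  rewrite exp_weight_gt0E ?(lt_le_trans ltr01)// -[leLHS]mul1r.
  apply: ler_pM => //.
    by rewrite -(powRr0 s) ler_powR.
  by rewrite ler_expR lerN2.
Qed.

Lemma Gamma_nat (m : nat) : Gamma (m%:R + 1) = m`!%:R :> R.
Proof.
apply: EFin_inj; rewrite -GammaE// -integral_expr_exp_weight.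
apply: eq_integral => s _; have [s0|s0] := leP s 0.
  by rewrite exp_weight_le0E// !mulr0.
by rewrite ger0_norm ?ltW// powR_mulrn// ltW.
Qed.

End GammaFacts.

(** * Sums along complementary coordinate subspaces *)

Section SplitSum.
Context {R : realType} (n : nat).
Notation T := (measurableTypeR R).
Notation lambda := (@lebesgue_measure R).
Notation mu := (lebesgueRn R n).
Implicit Types (K A : set 'rV[R]_n) (x z : 'rV[R]_n) (E : {set 'I_n}).

(** Projection to a coordinate subspace, as a 0-1 scaling: shrinkable sets are stable under it. *)
Definition restr E x : 'rV[R]_n := cmul (\row_i (i \in E)%:R) x.

Lemma restrE E x i : restr E x 0 i = if i \in E then x 0 i else 0.
Proof. by rewrite !mxE; case: (i \in E); rewrite ?mul1r ?mul0r. Qed.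

Lemma shrinkable_restr K E x : shrinkable K -> K x -> K (restr E x).
Proof.
by move=> sK Kx; apply: sK => // i; rewrite mxE; case: (i \in E); rewrite ?lexx ?ler01.
Qed.

Lemma continuous_cmul (d : 'rV[R]_n) : continuous (cmul d).
Proof.
apply: rV_continuous => i; rewrite (_ : (fun _ => _) = *%R (d 0 i) \o (fun x => x 0 i)).
  move=> x; apply: continuous_comp; first exact: coord_continuous.
  exact: mulrl_continuous.
by apply/funext => x; rewrite mxE.
Qed.

(** The set T_r(E). *)
Definition split_sum r E K := power_sum r (restr E @` K) (restr (~: E) @` K).

(** For shrinkable K, [restr E z] is in K exactly when it is in the projection of K, so this is the
    product of the two projections, with volume V(E). *)
Definition split_prod E K := [set z | K (restr E z)] `&` [set z | K (restr (~: E) z)].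

Lemma measurable_split_sum r E K : 0 <= r -> compact K ->
  measurable (rowset (split_sum r E K)).
Proof.
move=> r0 cK; apply: measurable_rowset_compact; apply: compact_power_sum => //.
all: apply: continuous_compact => //; apply: continuous_subspaceT.
all: exact: continuous_cmul.
Qed.

Lemma measurable_restr_preimage E K : compact K ->
  measurable (rowset [set z | K (restr E z)]).
Proof.
by move=> cK; apply: measurable_rowset_cmul; exact: measurable_rowset_compact.
Qed.

Lemma powRV (s r : R) : 0 <= s -> s^-1 `^ r = s `^ (- r).
Proof. by move=> s0; rewrite -powR_inv1// -powRrM mulN1r. Qed.

Lemma powR_div (s s' r : R) : 0 <= s -> 0 <= s' ->
  (s / s') `^ r = s `^ r * s' `^ (- r).
Proof. by move=> s0 s'0; rewrite powRM ?invr_ge0// powRV. Qed.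

Lemma powRNK (s r : R) : 0 < s -> s `^ r * s `^ (- r) = 1.
Proof. by move=> s0; rewrite powRN divff// gt_eqF// powR_gt0. Qed.

Lemma powR_le1 (s r : R) : 0 <= r -> 0 <= s <= 1 -> 0 <= s `^ r <= 1.
Proof.
move=> r0 /andP[s0 s1]; rewrite powR_ge0/= [leRHS](_ : 1 = 1 `^ r); last by rewrite powR1.
by apply: ge0_ler_powR; rewrite ?nnegrE.
Qed.

(* The section of [dil r A] at s > 0 is s^r A; writing it as a preimage makes joint
   measurability in (s, t) immediate. *)
Definition dil r A : set (T * n.-tuple T) :=
  [set st | 0 < st.1 /\ A (st.1 `^ (- r) *: \row_i tnth st.2 i)].

Lemma measurable_dil r A : measurable (rowset A) -> measurable (dil r A).
Proof.
move=> mA.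
pose f (st : T * n.-tuple T) : n.-tuple T :=
  [tuple st.1 `^ (- r) * tnth st.2 i | i < n].
have mf : measurable_fun setT f.
  apply: measurable_tuple_ord => i; apply: measurable_funM.
    apply: (measurableT_comp (measurable_powR (- r))).
    exact: measurable_fst.
  apply: (@measurableT_comp _ _ _ _ _ _ (fun t : n.-tuple T => tnth t i)).
    exact: (@measurable_tnth _ T n i).
  exact: measurable_snd.
rewrite (_ : dil r A = (fst @^-1` `]0, +oo[%classic) `&` (f @^-1` rowset A)).
  apply: measurableI; rewrite -[X in measurable X]setTI; last exact: mf.
  by apply: measurable_fst => //; exact: measurable_itv.
apply/seteqP; split => -[s t]; rewrite /dil/rowset/= in_itv/= andbT => -[s0 As].
all: split => //; move: As; congr (A _); apply/rowP => i.
all: by rewrite !mxE tnth_mktuple.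
Qed.

(** A point lies in s^r T_r(E) with parameter u when its blocks lie in ((1 - u) s)^r K and (u s)^r
    K. The two dilation parameters add up to s, which is the situation of [wexp_sum]. *)
Lemma wexp_split_sum r E K (t : n.-tuple T) : 0 <= r -> shrink_body K ->
  wexp [set s | dil r (split_sum r E K) (s, t)] =
  (wexp [set s | dil r [set z | K (restr E z)] (s, t)] *
   wexp [set s | dil r [set z | K (restr (~: E) z)] (s, t)])%E.
Proof.
move=> r0 [_ _ sK]; rewrite /dil/=; set z := \row_i tnth t i.
have sK' c x : 0 <= c <= 1 -> K x -> K (c *: x).
  move=> c01 Kx; rewrite (_ : c *: x = cmul (const_mx c) x).
    by apply: sK => // i; rewrite mxE.
  by apply/rowP => i; rewrite !mxE.
have sKr E' x : K x -> K (restr E' x) by exact: shrinkable_restr.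
(* Replacing s by a larger s' multiplies the rescaled point by (s / s')^r in [0, 1], which keeps it
   in K; hence the sets of admissible s are up-sets. *)
have ratio s s' : 0 <= s -> 0 < s' -> s <= s' -> 0 <= (s / s') `^ r <= 1.
  move=> s0 s'0 ss'; apply: powR_le1 => //.
  by rewrite divr_ge0 ?(ltW s'0)//= ler_pdivrMr// mul1r.
have up1 E' : upset [set s | 0 < s /\ K (restr E' (s `^ (- r) *: z))].
  move=> s s' /= [s0 Ks] ss'; have s'0 := lt_le_trans s0 ss'; split => //.
  have := sK' _ _ (ratio _ _ (ltW s0) s'0 ss') Ks.
  congr K; apply/rowP => i; rewrite mxE !restrE !mxE.
  case: ifP => _; last by rewrite mulr0.
  rewrite powR_div ?(ltW s0) ?(ltW s'0)//.
  rewrite [LHS](_ : _ = s' `^ (- r) * tnth t i * (s `^ r * s `^ (- r))).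
    by rewrite powRNK// mulr1.
  by ring.
apply: wexp_sum => //.
- move=> s s' /= [s0 [_ [_ [u [[x Kx <-] [y Ky <-] u01 zE]]]]] ss'.
  have s'0 := lt_le_trans s0 ss'; split => //.
  have q01 := ratio _ _ (ltW s0) s'0 ss'.
  exists (restr E ((s / s') `^ r *: x)), (restr (~: E) ((s / s') `^ r *: y)), u; split => //.
  + by exists ((s / s') `^ r *: x) => //; exact: sK'.
  + by exists ((s / s') `^ r *: y) => //; exact: sK'.
  + apply/rowP => i; have /rowP/(_ i) := zE; rewrite !mxE => zi.
    rewrite powR_div ?(ltW s0) ?(ltW s'0)//.
    have -> : s' `^ (- r) * tnth t i = s' `^ (- r) * s `^ r * (s `^ (- r) * tnth t i).
      by rewrite mulrA -(mulrA _ (s `^ r)) powRNK// mulr1.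
    by rewrite zi; ring.
- by move=> s [s0 _]; rewrite /= in_itv/= s0.
- by move=> s [s0 _]; rewrite /= in_itv/= s0.
- by move=> s [s0 _]; rewrite /= in_itv/= s0.
- move=> s1 s2 /= [s10 K1] [s20 K2]; have s0 : 0 < s1 + s2 by exact: addr_gt0.
  split => //.
  (* The parameter is the share of s2 in s1 + s2. The inner [restr] is the point known to lie in K,
     the outer one its projection. *)
  exists (restr E (restr E (s1 `^ (- r) *: z))),
    (restr (~: E) (restr (~: E) (s2 `^ (- r) *: z))), (s2 / (s1 + s2)); split.
  + by exists (restr E (s1 `^ (- r) *: z)).
  + by exists (restr (~: E) (s2 `^ (- r) *: z)).
  + by rewrite divr_ge0 ?(ltW s0) ?(ltW s20)//= ler_pdivrMr// mul1r lerDr ltW.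
  + have -> : 1 - s2 / (s1 + s2) = s1 / (s1 + s2).
      by field; rewrite gt_eqF.
    rewrite !powR_div ?(ltW s0) ?(ltW s10) ?(ltW s20)//.
    apply/rowP => i; rewrite !mxE inE.
    have e1 := powRNK r s10; have e2 := powRNK r s20.
    case: (i \in E) => /=; rewrite !(mul1r, mul0r, mulr0, addr0, add0r).
      rewrite [RHS](_ : _ = (s1 + s2) `^ (- r) * tnth t i * (s1 `^ r * s1 `^ (- r))).
        by rewrite e1 mulr1.
      by ring.
    rewrite [RHS](_ : _ = (s1 + s2) `^ (- r) * tnth t i * (s2 `^ r * s2 `^ (- r))).
      by rewrite e2 mulr1.
    by ring.
- move=> s e /= [s0 [_ [_ [u [[x Kx <-] [y Ky <-] /andP[u0 u1] zE]]]]] e0.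
  (* The parameters (1 - u) s and u s may vanish, while [dil] asks for positive ones; each receives
     half of e. *)
  have e20 : 0 < e / 2 by rewrite divr_gt0.
  have us0 : 0 <= (1 - u) * s by rewrite mulr_ge0 ?subr_ge0// ltW.
  have us0' : 0 <= u * s by rewrite mulr_ge0// ltW.
  have s10 : 0 < (1 - u) * s + e / 2 by rewrite ltr_wpDl.
  have s20 : 0 < u * s + e / 2 by rewrite ltr_wpDl.
  have zi i : tnth t i = s `^ r * ((1 - u) `^ r * restr E x 0 i + u `^ r * restr (~: E) y 0 i).
    have /rowP/(_ i) := zE; rewrite [LHS]mxE [X in _ * X]mxE => zi.
    rewrite -[LHS]mul1r -[X in X * _](powRNK r s0) -mulrA zi; congr (_ * _).
    by rewrite mxE [X in X + _]mxE [X in _ + X]mxE.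
  exists ((1 - u) * s + e / 2), (u * s + e / 2); split; last by lra.
  + split => //.
    have := sKr E _ (sK' _ _ (ratio _ _ us0 s10 _) Kx); rewrite lerDl (ltW e20) => /(_ isT).
    congr K; apply/rowP => i; rewrite powR_div ?(ltW s10)// powRM ?subr_ge0//; last exact: ltW.
    rewrite !restrE; case: ifP => // iE; rewrite !mxE zi !restrE inE iE/=; ring.
  + split => //.
    have := sKr (~: E) _ (sK' _ _ (ratio _ _ us0' s20 _) Ky); rewrite lerDl (ltW e20) => /(_ isT).
    congr K; apply/rowP => i; rewrite powR_div ?(ltW s20)// powRM//; last exact: ltW.
    rewrite !restrE; case: ifP => // iE; rewrite !mxE zi !restrE iE.
    move: iE; rewrite inE => /negPf ->; ring.
Qed.

Lemma powR_expn (s r : R) (k : nat) : (s `^ r) ^+ k = s `^ (k%:R * r).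
Proof. by rewrite mulrC powRrM powR_mulrn// powR_ge0. Qed.

Lemma EFin_mul_exp_weight (c s : R) : ((c * exp_weight s)%:E = (exp_weight s)%:E * c%:E)%E.
Proof. by rewrite -EFinM mulrC. Qed.

Lemma volume_dil r A (s : R) : 0 < s -> measurable (rowset A) ->
  mu [set t | dil r A (s, t)] = ((s `^ (n%:R * r))%:E * volume A)%E.
Proof.
move=> s0 mA.
have sr : s `^ (- r) != 0 by rewrite gt_eqF// powR_gt0.
have := @volume_cmul R n (const_mx (s `^ (- r))) A.
rewrite (eq_bigr (fun=> s `^ r)) => [|i _]; last first.
  by rewrite mxE ger0_norm ?powR_ge0// powRN invrK.
rewrite prodr_const card_ord powR_expn => <- //; last by move=> i; rewrite mxE.
rewrite volumeE; congr (mu _); apply/seteqP; split => t; rewrite /dil/rowset/=.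
  by move=> [_]; congr (A _); apply/rowP => i; rewrite !mxE.
by move=> At; split => //; move: At; congr (A _); apply/rowP => i; rewrite !mxE.
Qed.

Lemma integral_wexp_dil r A : 0 <= r -> measurable (rowset A) ->
  (\int[mu]_t wexp [set s | dil r A (s, t)] =
   (Gamma (n%:R * r + 1))%:E * volume A)%E.
Proof.
move=> r0 mA; have mG := measurable_dil r mA.
have nr0 : 0 <= n%:R * r by rewrite mulr_ge0.
transitivity (\int[mu]_t (wexp [set s | dil r A (s, t)] * 1))%E.
  by apply: eq_integral => t _; rewrite mule1.
rewrite -(@tonelli_exp_weight R _ _ mu _ mG (cst 1%E))//.
rewrite -GammaE// -ge0_integralZr//; last 2 first.
- apply/measurable_EFinP; apply: measurable_funM; last exact: measurable_exp_weight.
  exact: measurable_powR.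
- by move=> s _; rewrite lee_fin mulr_ge0 ?exp_weight_ge0// powR_ge0.
apply: eq_integral => s _; have [s0|s0] := leP s 0.
  by rewrite exp_weight_le0E// mulr0 !mul0e.
rewrite EFin_mul_exp_weight -muleA; congr (_ * _)%E.
rewrite -volume_dil//.
transitivity (\int[mu]_z ((\1_[set t | dil r A (s, t)] z : R)%:E))%E.
  by apply: eq_integral => t _; rewrite /= mule1 !indicE; congr (_%:R)%:E; rewrite !inE.
rewrite integral_indic ?setIT//.
rewrite -[X in measurable X]setTI.
exact: (pair1_measurable s measurableT mG).
Qed.

(** Each condition sees only its own block of coordinates, so together they form the preimage of
    [split_prod] under one diagonal scaling with a different factor on each block. *)
Lemma volume_split_dil r E K (s1 s2 : R) : 0 < s1 -> 0 < s2 -> compact K ->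
  mu ([set t | dil r [set z | K (restr E z)] (s1, t)] `&`
      [set t | dil r [set z | K (restr (~: E) z)] (s2, t)]) =
  ((s1 `^ (#|E|%:R * r) * s2 `^ (#|~: E|%:R * r))%:E * volume (split_prod E K))%E.
Proof.
move=> s10 s20 cK.
pose d : 'rV[R]_n := \row_i (if i \in E then s1 `^ (- r) else s2 `^ (- r)).
have mV : measurable (rowset (split_prod E K)).
  by apply: measurableI; exact: measurable_restr_preimage.
have d0 i : d 0 i != 0.
  by rewrite mxE; case: ifP => _; rewrite gt_eqF// powR_gt0.
have := volume_cmul d0 mV.
rewrite (_ : \prod_i _ = s1 `^ (#|E|%:R * r) * s2 `^ (#|~: E|%:R * r)); last first.
  rewrite (bigID (mem E))/= -!powR_expn -!prodr_const; congr (_ * _).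
    by apply: eq_bigr => i iE; rewrite mxE iE ger0_norm ?powR_ge0// powRN invrK.
  apply: eq_big => i; first by rewrite inE.
  by move=> /negPf iE; rewrite mxE iE ger0_norm ?powR_ge0// powRN invrK.
move=> <-; rewrite volumeE; congr (mu _).
have e1 x : restr E (cmul d x) = restr E (s1 `^ (- r) *: x).
  by apply/rowP => i; rewrite !mxE; case: (i \in E); rewrite ?mul0r.
have e2 x : restr (~: E) (cmul d x) = restr (~: E) (s2 `^ (- r) *: x).
  by apply/rowP => i; rewrite !mxE inE; case: (i \in E); rewrite ?mul0r.
apply/seteqP; split => t; rewrite /dil/split_prod/rowset/= e1 e2.
  by move=> [[_ K1] [_ K2]].
by move=> [K1 K2].
Qed.

(** Tonelli twice: the weight over E is unfolded first, with the other weight as factor, then that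
    one, with the indicator of the slice as factor. What remains is the volume of two independently
    dilated blocks, and the powers of s and u integrate to the two Gamma values. *)
Lemma integral_wexp_split r E K : 0 <= r -> compact K ->
  (\int[mu]_t (wexp [set s | dil r [set z | K (restr E z)] (s, t)] *
     wexp [set s | dil r [set z | K (restr (~: E) z)] (s, t)]) =
   (Gamma (#|E|%:R * r + 1) * Gamma (#|~: E|%:R * r + 1))%:E *
     volume (split_prod E K))%E.
Proof.
move=> r0 cK.
have mG1 := measurable_dil r (measurable_restr_preimage E cK).
have mG2 := measurable_dil r (measurable_restr_preimage (~: E) cK).
set G1 := dil r _ in mG1 *; set G2 := dil r _ in mG2 *.
have k0 E' : 0 <= #|E'|%:R * r by rewrite mulr_ge0.
have mpow k : measurable_fun setT (fun s : T => (s `^ k * exp_weight s)%:E).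
  apply/measurable_EFinP; apply: measurable_funM; last exact: measurable_exp_weight.
  exact: measurable_powR.
have pow0 k s : (0 <= (s `^ k * exp_weight s)%:E)%E.
  by rewrite lee_fin mulr_ge0 ?exp_weight_ge0// powR_ge0.
have mS (G : set (T * n.-tuple T)) s : measurable G -> measurable [set t | G (s, t)].
  by move=> mG; rewrite -[X in measurable X]setTI; exact: (pair1_measurable s measurableT mG).
rewrite -(@tonelli_exp_weight R _ _ mu _ mG1 (fun t => wexp [set s | G2 (s, t)])); last 2 first.
- exact: measurable_wexp_section.
- by move=> t; exact: wexp_ge0.
transitivity (\int[lambda]_s ((s `^ (#|E|%:R * r) * exp_weight s)%:E *
    ((Gamma (#|~: E|%:R * r + 1))%:E * volume (split_prod E K))))%E; last first.
  rewrite ge0_integralZr; first by rewrite GammaE// muleA EFinM.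
  - exact: measurableT.
  - exact: mpow.
  - by move=> s _; exact: pow0.
  - by rewrite mule_ge0// lee_fin ltW// Gamma_gt0.
apply: eq_integral => s _; have [s0|s0] := leP s 0.
  by rewrite exp_weight_le0E// mulr0 !mul0e.
rewrite EFin_mul_exp_weight -muleA; congr (_ * _)%E.
transitivity (\int[mu]_t (wexp [set s | G2 (s, t)] * (\1_[set t | G1 (s, t)] t : R)%:E))%E.
  apply: eq_integral => t _; rewrite muleC; congr (_ * _%:E)%E.
rewrite -(@tonelli_exp_weight R _ _ mu _ mG2 (fun t => (\1_[set t | G1 (s, t)] t : R)%:E)); last 2 first.
- by apply/measurable_EFinP; apply: measurable_indic; exact: mS.
- by move=> t; rewrite lee_fin indicE.
rewrite -GammaE// muleA -ge0_integralZl; last 4 first.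
- exact: measurableT.
- exact: mpow.
- by move=> u _; exact: pow0.
- by rewrite lee_fin powR_ge0.
rewrite -ge0_integralZr; last 4 first.
- exact: measurableT.
- exact: measurable_funeM.
- by move=> u _; rewrite mule_ge0// lee_fin powR_ge0.
- exact: measure_ge0.
apply: eq_integral => u _; have [u0|u0] := leP u 0.
  by rewrite exp_weight_le0E// mulr0 mul0e mule0 mul0e.
rewrite EFin_mul_exp_weight muleCA -muleA; congr (_ * _)%E.
rewrite -EFinM -volume_split_dil//.
transitivity (\int[mu]_t ((\1_([set t | G1 (s, t)] `&` [set t | G2 (u, t)]) t : R)%:E))%E.
  apply: eq_integral => t _; rewrite -EFinM !indicE -natrM mulnb in_setI andbC.
  by congr (_%:R)%:E; congr (nat_of_bool (_ && _)); rewrite !inE.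
by rewrite integral_indic ?setIT//; apply: measurableI; exact: mS.
Qed.

(* Integrating exp (- s) over the s with t in s^r A gives Gamma (n r + 1) |A| by Tonelli; for the
   split sum this integrand factors pointwise in t, one factor for each of E and its complement. *)
Lemma volume_split_sum r E K : 0 <= r -> shrink_body K ->
  ((Gamma (n%:R * r + 1))%:E * volume (split_sum r E K) =
   (Gamma (#|E|%:R * r + 1) * Gamma (#|~: E|%:R * r + 1))%:E *
     volume (split_prod E K))%E.
Proof.
move=> r0 gK; have [cK _ _] := gK.
rewrite -integral_wexp_dil//; last exact: measurable_split_sum.
rewrite -integral_wexp_split//; apply: eq_integral => t _.
exact: wexp_split_sum.
Qed.

End SplitSum.

(** * The upper bound *)

Section UpperBound.
Context {R : realType} (n : nat).
Notation mu := (lebesgueRn R n).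
Implicit Types (K A : set 'rV[R]_n) (x z : 'rV[R]_n) (E : {set 'I_n}).

(** Inverse of the binomial of n r over #|E| r; it is the ratio of |T_r(E)| to V(E). *)
Definition split_coef r E : R :=
  Gamma (#|E|%:R * r + 1) * Gamma (#|~: E|%:R * r + 1) / Gamma (n%:R * r + 1).

Lemma split_coef_ge0 r E : 0 <= r -> 0 <= split_coef r E.
Proof.
by move=> r0; rewrite divr_ge0 ?mulr_ge0// ltW// Gamma_gt0// mulr_ge0.
Qed.

Lemma volume_split_sumE r E K : 0 <= r -> shrink_body K ->
  volume (split_sum r E K) = ((split_coef r E)%:E * volume (split_prod E K))%E.
Proof.
move=> r0 gK; have G0 : 0 < Gamma (n%:R * r + 1) :> R by rewrite Gamma_gt0// mulr_ge0.
rewrite /split_coef mulrC EFinM -muleA -volume_split_sum// muleA -EFinM.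
by rewrite mulVf ?gt_eqF// mul1e.
Qed.

Lemma card_setC_ord E : #|~: E| = (n - #|E|)%N.
Proof. by have /(canRL (addKn _)) := cardsC E; rewrite card_ord. Qed.

Lemma card_set_ord E : (#|E| <= n)%N.
Proof. by have := max_card (mem E); rewrite card_ord. Qed.

Lemma split_coef1 E : split_coef 1 E = ('C(n, #|E|)%:R)^-1.
Proof.
rewrite /split_coef !mulr1 !Gamma_nat card_setC_ord -(bin_fact (card_set_ord E)).
rewrite !natrM invfM mulrCA divff ?mulr1//.
Qed.

(** Of the squared binomial in [kappa], one factor counts the sets E of cardinality i and the other
    is the bound on V(E) / |K|. *)
Lemma kappaE q : 0 <= rinv q ->
  kappa n q = \sum_(E : {set 'I_n}) split_coef (rinv q) E * 'C(n, #|E|)%:R.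
Proof.
move=> r0; rewrite (partition_big (fun E => inord #|E| : 'I_n.+1) predT)//=.
apply: eq_bigr => i _.
have cE E : (inord #|E| == i) = (#|E| == i :> nat).
  by rewrite -(inj_eq val_inj)/= inordK// ltnS card_set_ord.
rewrite (eq_bigl (fun E => E \in [set A : {set 'I_n} | #|A| == i]%SET)); last first.
  by move=> E; rewrite inE cE.
pose c := Gamma (i%:R * rinv q + 1) * Gamma ((n - i)%:R * rinv q + 1) /
  Gamma (n%:R * rinv q + 1) * 'C(n, i)%:R.
rewrite (eq_bigr (fun=> c)); last first.
  by move=> E; rewrite inE => /eqP iE; rewrite /split_coef card_setC_ord iE.
rewrite sumr_const card_draws card_ord /rbin.
have -> : n%:R * rinv q - i%:R * rinv q = (n - i)%:R * rinv q.
  by rewrite -mulrBl natrB// -ltnS.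
by rewrite invf_div expr2 mulrA -[RHS]mulr_natr.
Qed.

Lemma split_sum1_sub E K : shrink_body K -> split_sum 1 E K `<=` K.
Proof.
move=> [_ vK sK] z [_ [_ [t [[x Kx <-] [y Ky <-] /andP[t0 t1] ->]]]].
rewrite !powRr1// ?subr_ge0//; apply: vK; rewrite ?t0//; exact: shrinkable_restr.
Qed.

Lemma volume_split_prod_le E K : shrink_body K ->
  (volume (split_prod E K) <= 'C(n, #|E|)%:R%:E * volume K)%E.
Proof.
move=> gK; have [cK _ _] := gK.
have C0 : (0 < 'C(n, #|E|)%:R :> R) by rewrite ltr0n bin_gt0 card_set_ord.
have : (volume (split_sum 1 E K) <= volume K)%E.
  apply: le_volume; last exact: split_sum1_sub.
    exact: measurable_split_sum.
  exact: measurable_rowset_compact.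
rewrite volume_split_sumE// split_coef1.
move/(lee_wpmul2l (x := 'C(n, #|E|)%:R%:E)); rewrite lee_fin (ltW C0) => /(_ isT).
by rewrite muleA -EFinM divff ?gt_eqF// mul1e.
Qed.

Definition reflect_out E : 'rV[R]_n := \row_i (if i \in E then 1 else -1).

Lemma cmul_reflectK E x : cmul (reflect_out E) (cmul (reflect_out E) x) = x.
Proof.
by apply/rowP => i; rewrite !mxE; case: ifP => _; rewrite ?mul1r// !mulN1r opprK.
Qed.

(** The part of index E: coordinates in E come from K, the others from -K. *)
Definition reflected_sum r E K := [set z | split_sum r E K (cmul (reflect_out E) z)].

Lemma measurable_reflected_sum r E K : 0 <= r -> compact K ->
  measurable (rowset (reflected_sum r E K)).
Proof.
by move=> r0 cK; apply: measurable_rowset_cmul; exact: measurable_split_sum.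
Qed.

Lemma volume_reflected_sum r E K : 0 <= r -> compact K ->
  volume (reflected_sum r E K) = volume (split_sum r E K).
Proof.
move=> r0 cK; rewrite volume_cmul; last exact: measurable_split_sum.
  by rewrite big1 ?mul1e// => i _; rewrite mxE; case: ifP; rewrite ?normrN normr1 invr1.
by move=> i; rewrite mxE; case: ifP => _; rewrite ?oppr_eq0 oner_eq0.
Qed.

(** Where z_i = a u_i - b v_i has the sign d_i of the orthant, it lies between 0 and a u_i;
    elsewhere -z_i lies between 0 and b v_i. E collects the coordinates of the first kind, and u and
    v are shrunk to fit with t unchanged. *)
Lemma power_sum_neg_sub_reflected r K (d : 'I_n -> R) : shrink_body K ->
  (forall i, d i = 1 \/ d i = -1) -> (forall x, K x -> forall i, 0 <= d i * x 0 i) ->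
  forall z, power_sum r K (neg_set K) z -> exists E, reflected_sum r E K z.
Proof.
move=> [cK _ sK] d1 Kd z [u [_ [t [Ku [v Kv <-] t01 zE]]]].
set a := (1 - t) `^ r in zE; set b := t `^ r in zE.
have a0 : 0 <= a by exact: powR_ge0.
have b0 : 0 <= b by exact: powR_ge0.
have ratio (e w c : R) : e = 1 \/ e = -1 -> 0 <= e * w -> e * w <= e * c ->
    0 <= w / c <= 1 /\ w = w / c * c.
  move=> e1 ew ewc; have [c0|c0] := eqVneq c 0.
    rewrite c0 mulr0 in ewc *; rewrite invr0 mulr0 lexx ler01 mulr0; split => //.
    by case: e1 ew ewc => ->; lra.
  split; last by rewrite divfK.
  have [cp|cn] : 0 < c \/ c < 0 by apply/orP; rewrite -neq_lt eq_sym.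
    by rewrite ler_pdivlMr// ler_pdivrMr// mul0r mul1r; case: e1 ew ewc => ->; lra.
  by rewrite ler_ndivlMr// ler_ndivrMr// mul0r mul1r; case: e1 ew ewc => ->; lra.
have zi i : z 0 i = a * u 0 i - b * v 0 i by rewrite zE !mxE mulrN.
pose E := [set i | 0 <= d i * z 0 i]%SET; exists E.
have du i : 0 <= d i * (a * u 0 i) by rewrite mulrCA mulr_ge0 ?Kd.
have dv i : 0 <= d i * (b * v 0 i) by rewrite mulrCA mulr_ge0 ?Kd.
(* Shrinking factors for u on E and for v outside. Where a denominator vanishes, z_i = 0 and the
   default quotient 0 is right. *)
pose p i := z 0 i / (a * u 0 i).
pose q i := - z 0 i / (b * v 0 i).
have pE i : i \in E -> 0 <= p i <= 1 /\ z 0 i = p i * (a * u 0 i).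
  rewrite inE => iE; apply: (ratio (d i)) => //.
  by rewrite zi mulrBr gerBl.
have qE i : i \notin E -> 0 <= q i <= 1 /\ - z 0 i = q i * (b * v 0 i).
  rewrite inE -ltNge => iE; apply: (ratio (d i)) => //.
    by rewrite mulrN oppr_ge0 ltW.
  by rewrite mulrN zi mulrBr opprB gerBl.
pose x := cmul (\row_i (if i \in E then p i else 0)) u.
pose y := cmul (\row_i (if i \in E then 0 else q i)) v.
have Kx : K x.
  apply: sK => // i; rewrite mxE; case: ifPn => iE; last by rewrite lexx ler01.
  exact: (pE i iE).1.
have Ky : K y.
  apply: sK => // i; rewrite mxE; case: ifPn => iE; first by rewrite lexx ler01.
  exact: (qE i iE).1.
exists (restr E x), (restr (~: E) y), t; split => //; first by exists y.
apply/rowP => i; rewrite !mxE finset.in_setC.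
case: (boolP (i \in E)) => iE; rewrite /= !(mul1r, mul0r, mulr0, addr0, add0r) ?mulN1r.
  by rewrite (pE _ iE).2 mulrCA.
by rewrite (qE _ iE).2 mulrCA.
Qed.

Lemma lebesgueRn_bigU (I : finType) (A : I -> set (n.-tuple (measurableTypeR R))) :
  (forall i, measurable (A i)) ->
  (mu (\big[setU/set0]_i A i) <= \sum_i mu (A i))%E.
Proof.
move=> mA.
suff [_ //] : measurable (\big[setU/set0]_i A i) /\
  (mu (\big[setU/set0]_i A i) <= \sum_i mu (A i))%E.
apply: (big_rec2 (fun X s => measurable X /\ (mu X <= s)%E)).
  by rewrite measure0.
move=> i X s _ [mX Xs]; split; first exact: measurableU.
by apply: (le_trans (measureU2 _ (mA i) mX)); rewrite leeD.
Qed.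

Lemma volume_power_sum_neg_le q K : 0 <= rinv q -> shrink_body K ->
  (volume (power_sum (rinv q) K (neg_set K)) <= (kappa n q)%:E * volume K)%E.
Proof.
move=> r0; apply: volume_power_sum_neg_orthant => //.
  by rewrite kappaE//; apply: sumr_ge0 => E _; rewrite mulr_ge0// split_coef_ge0.
move=> {}K gK [d d1 Kd]; have [cK _ _] := gK.
have mA E := measurable_reflected_sum E r0 cK.
apply: (@le_trans _ _ (\sum_(E : {set 'I_n}) volume (reflected_sum (rinv q) E K))%E).
  apply: le_trans (lebesgueRn_bigU mA); apply: le_measure; rewrite ?inE.
  - exact: measurable_rowset_power_sum_neg.
  - by apply: bigsetU_measurable => E _.
  - move=> t /(power_sum_neg_sub_reflected gK d1 Kd)[E Et].
    by rewrite -bigcup_seq; exists E => //=; rewrite mem_index_enum.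
rewrite kappaE// -sumEFin ge0_sume_distrl; last first.
  by move=> E _; rewrite lee_fin mulr_ge0// split_coef_ge0.
apply: lee_sum => E _; rewrite volume_reflected_sum// volume_split_sumE// [(_ * _%:R)%:E]EFinM -muleA.
by apply: lee_wpmul2l; [rewrite lee_fin split_coef_ge0|exact: volume_split_prod_le].
Qed.

End UpperBound.

(** * Locally anti-blocking bodies *)

Section LowerBound.
Context {R : realType} (n : nat).
Notation T := (measurableTypeR R).
Notation mu := (lebesgueRn R n).
Implicit Types (K A : set 'rV[R]_n) (x z : 'rV[R]_n) (E : {set 'I_n}).

Lemma coord_subspaceP E z :
  reflect (forall i, i \notin E -> z 0 i = 0) (z \in coord_subspace E).
Proof.
apply: (iffP idP) => [|z0].
  rewrite /coord_subspace; set X := [seq _ | _ <- _] => zX i iE.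
  rewrite (coord_span (X := in_tuple X) zX) summxE big1// => k _.
  rewrite mxE.
  have /mapP[j jE ->] : X`_k \in X by rewrite mem_nth.
  rewrite mem_enum in jE; rewrite mxE (_ : i == j = false) ?andbF ?mulr0//.
  by apply/negbTE; apply: contraNneq iE => ->.
rewrite (row_sum_delta z) memv_suml// => i _.
have [iE|iE] := boolP (i \in E); last by rewrite z0// scale0r mem0v.
by rewrite memvZ// memv_span//; apply/mapP; exists i; rewrite ?mem_enum.
Qed.

Lemma restr_in_coord_subspace E z : restr E z \in coord_subspace E.
Proof. by apply/coord_subspaceP => i /negPf iE; rewrite restrE iE. Qed.

Lemma orthogonal_coord_subspace E (w : 'rV[R]_n) :
  (forall z, z \in coord_subspace E -> w *m z^T = 0) <->
  (forall i, i \in E -> w 0 i = 0).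
Proof.
split => [wE i iE|wE z /coord_subspaceP zE].
  have /matrixP/(_ 0 0) : w *m (delta_mx 0 i : 'rV[R]_n)^T = 0.
    apply: wE; apply/coord_subspaceP => j jE; rewrite mxE/=.
    by rewrite (_ : j == i = false)//; apply/negbTE; apply: contraNneq jE => ->.
  rewrite !mxE (bigD1 i)//= big1 ?addr0; first by rewrite !mxE !eqxx mulr1.
  by move=> j /negPf ji; rewrite !mxE ji andbF mulr0.
apply/matrixP => a b; rewrite !mxE big1// => i _; rewrite !mxE.
rewrite [a]ord1 [b]ord1; have [iE|iE] := boolP (i \in E).
  by rewrite wE// mul0r.
by rewrite zE// mulr0.
Qed.

Lemma convex_setP (K : set 'rV[R]_n) : convex_set K <->
  (forall x y t, K x -> K y -> 0 <= t <= 1 -> K ((1 - t) *: x + t *: y)).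
Proof.
split => [cK x y t Kx Ky /andP[t0 t1]|cK x y l /set_mem Kx /set_mem Ky].
  have := cK y x (Itv01 t0 t1) (mem_set Ky) (mem_set Kx).
  by move/set_mem; rewrite addrC.
apply/mem_set; rewrite /conv/= addrC; apply: cK => //.
by apply/andP; split; [exact: ge0|exact: le1].
Qed.

(* Scaling coordinate k by c in [0, 1] is a convex combination of a point and its projection
   along k. *)
Lemma locally_anti_blocking_shrink_body K : locally_anti_blocking K -> K !=set0 /\ shrink_body K.
Proof.
move=> [[K0 cK /convex_setP vK] aK]; split => //; split => // x d Kx d01.
(* Reflected by its own signs s, y enters the nonnegative orthant, where anti-blocking keeps its
   projection in the reflected body; reflecting again returns to K. *)
have rK E y : K y -> K (restr E y).
  move=> Ky; pose s : 'rV[R]_n := \row_i (if 0 <= y 0 i then 1 else -1).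
  have s1 i : s 0 i = 1 \/ s 0 i = -1 by rewrite mxE; case: ifP; [left|right].
  have ss i c : s 0 i * (s 0 i * c) = c.
    by rewrite mulrA; case: (s1 i) => ->; rewrite ?mulr1 ?mulN1r ?opprK mul1r.
  have [_ _ /(_ E) projE] := aK s s1.
  have sy : (coord_scale s K `&` @nonneg_orthant R n) (cmul s y).
    split; first by exists y.
    move=> i; rewrite !mxE; have [i0|i0] := leP 0 (y 0 i); first by rewrite mul1r.
    by rewrite mulN1r oppr_ge0 ltW.
  have : proj_image (coord_subspace E) (coord_scale s K `&` @nonneg_orthant R n)
      (restr E (cmul s y)).
    split; first exact: restr_in_coord_subspace.
    exists (cmul s y) => //; apply/orthogonal_coord_subspace => i iE.
    by rewrite mxE [X in _ + X]mxE restrE iE subrr.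
  rewrite projE => -[[[w Kw /rowP wE] _] _].
  rewrite (_ : restr E y = w)//; apply/rowP => i.
  have := wE i; rewrite mxE => /(congr1 ( *%R (s 0 i))); rewrite ss => ->.
  rewrite !restrE; case: ifP => _; last by rewrite mulr0.
  by rewrite [X in _ = _ * X]mxE ss.
have step k c y : 0 <= c <= 1 -> K y -> K (set_coord y k (c * y 0 k)).
  move=> c01 Ky; have := vK _ _ c (rK (~: [set k])%SET _ Ky) Ky c01.
  congr K; apply/rowP => i; rewrite !mxE !inE.
  by case: eqP => [->|_] /=; rewrite ?mul0r ?mulr0 ?add0r ?mul1r//; ring.
(* Coordinates are scaled one at a time; m of them are done. *)
pose dm m : 'rV[R]_n := \row_i (if (i < m)%N then d 0 i else 1).
suff H m : (m <= n)%N -> K (cmul (dm m) x).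
  have := H n (leqnn n); congr K; apply/rowP => i; rewrite !mxE ltn_ord//.
elim: m => [_|m IHm mn].
  rewrite (_ : cmul _ _ = x)//.
  by apply/rowP => i; rewrite !mxE mul1r.
have := step (Ordinal mn) _ _ (d01 (Ordinal mn)) (IHm (ltnW mn)).
congr K; apply/rowP => i; rewrite !mxE ltnn mul1r ltnS [(i <= m)%N]leq_eqVlt.
have [->|iE] := eqVneq i (Ordinal mn); first by rewrite /= eqxx.
by rewrite -(inj_eq val_inj)/= in iE; rewrite (negPf iE).
Qed.

(** The converse, which admits the simplex as a test body. *)
Lemma shrink_body_locally_anti_blocking K : K !=set0 -> shrink_body K -> locally_anti_blocking K.
Proof.
move=> K0 [cK vK sK]; split; first by split => //; exact/convex_setP.
move=> d d1.
have dd i c : d 0 i * (d 0 i * c) = c.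
  by rewrite mulrA; case: (d1 i) => ->; rewrite ?mulr1 ?mulN1r ?opprK mul1r.
(* A sign vector is its own inverse, so the image under it is also a preimage, and membership
   reduces to membership in K. *)
have KdE : coord_scale d K `&` @nonneg_orthant R n =
    [set x | K (cmul d x) /\ forall i, 0 <= x 0 i].
  apply/seteqP; split => x /=.
    move=> [[w Kw <-] x0]; split => //.
    by move: Kw; congr K; apply/rowP => i; rewrite !mxE dd.
  move=> [Kx x0]; split => //; exists (cmul d x) => //.
  by apply/rowP => i; rewrite !mxE dd.
rewrite KdE; set C := [set x | _].
have sC x (e : 'rV[R]_n) : C x -> (forall i, 0 <= e 0 i <= 1) -> C (cmul e x).
  move=> [Kx x0] e01; split.
    have := sK _ _ Kx e01; congr K; apply/rowP => i; rewrite !mxE; ring.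
  by move=> i; rewrite mxE mulr_ge0//; case/andP: (e01 i).
have vC x y t : C x -> C y -> 0 <= t <= 1 -> C ((1 - t) *: x + t *: y).
  move=> [Kx x0] [Ky y0] t01; split.
    have := vK _ _ _ Kx Ky t01; congr K; apply/rowP => i; rewrite !mxE; ring.
  by case/andP: t01 => t0 t1 i; rewrite !mxE addr_ge0// mulr_ge0// subr_ge0.
have rC E x : C x -> C (restr E x) by apply: shrinkable_restr; exact: sC.
split.
- split.
  + have [x Kx] := K0; exists 0; split => [|i]; last by rewrite mxE.
    have := sK _ 0 Kx; rewrite (_ : cmul 0 x = cmul d 0); first apply.
      by move=> i; rewrite mxE lexx ler01.
    by apply/rowP => i; rewrite !mxE mul0r mulr0.
  + rewrite (_ : C = (cmul d @` K) `&`
      \bigcap_(i in [set: 'I_n]) [set x | 0 <= 1 * x 0 i]).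
      apply: compact_closedI; first apply: continuous_compact => //.
        by apply: continuous_subspaceT; exact: continuous_cmul.
      by apply: closed_bigI => i _; exact: closed_half.
    apply/seteqP; split => x /=.
      move=> [Kx x0]; split; last by move=> i _ /=; rewrite mul1r.
      by exists (cmul d x) => //; apply/rowP => i; rewrite !mxE dd.
    move=> [[w Kw <-] x0]; split; last by move=> i; have := x0 i I; rewrite /= mul1r.
    by move: Kw; congr K; apply/rowP => i; rewrite !mxE dd.
  + exact/convex_setP.
- by move=> x [_ ].
- move=> E; apply/seteqP; split => y.
    move=> [/coord_subspaceP yE [x Cx /orthogonal_coord_subspace xy]].
    have -> : y = restr E x.
      apply/rowP => i; rewrite restrE; case: ifPn => [iE|/yE//].
      by have := xy _ iE; rewrite !mxE => /eqP; rewrite subr_eq0 => /eqP.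
    by split; [exact: rC|exact: restr_in_coord_subspace].
  move=> [Cy /= yE]; split => //; exists y => // z _.
  by rewrite subrr mul0mx.
Qed.

End LowerBound.

(** * Sharpness: the simplex *)

Section Simplex.
Context {R : realType} (n : nat).
Notation mu := (lebesgueRn R n).
Implicit Types (K A : set 'rV[R]_n) (x z : 'rV[R]_n) (E : {set 'I_n}).

Definition simplex : set 'rV[R]_n :=
  [set x | (forall i, 0 <= x 0 i) /\ \sum_i x 0 i <= 1].

Lemma simplex_le1 x : simplex x -> forall i, x 0 i <= 1.
Proof.
move=> [x0 x1] i; apply: le_trans x1; rewrite (bigD1 i)//= lerDl.
by apply: sumr_ge0.
Qed.

Lemma compact_box (a b : R) : compact [set x : 'rV[R]_n | forall i, `[a, b]%classic (x 0 i)].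
Proof. by apply: (@rV_compact R n (fun=> `[a, b]%classic)) => i; exact: segment_compact. Qed.

Lemma volume_box (a b : R) : a <= b ->
  volume [set x : 'rV[R]_n | forall i, `[a, b]%classic (x 0 i)] = ((b - a) ^+ n)%:E.
Proof.
move=> ab; have := @volume_rect R n (fun=> `[a, b]%classic).
move=> -> => [|i]; last exact: measurable_itv.
rewrite (eq_bigr (fun=> (b - a)%:E)) => [|i _].
  by rewrite -[in RHS](card_ord n) -prodr_const -prodEFin.
rewrite lebesgue_measure_itv/= lte_fin; case: ltP => // ba.
by rewrite (_ : b - a = 0)//; apply/eqP; rewrite subr_eq0 eq_le ba ab.
Qed.

Lemma shrink_body_simplex : shrink_body simplex.
Proof.
split.
- rewrite (_ : simplex = [set x | forall i, `[0, 1]%classic (x 0 i)] `&`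
      [set x | \sum_i x 0 i <= 1]).
    apply: compact_closedI; first exact: compact_box.
    apply: (@closed_comp _ _ (fun x : 'rV[R]_n => \sum_i x 0 i) [set c : R | c <= 1]);
      last exact: closed_le.
    move=> x _; suff: forall s : seq 'I_n, continuous (fun x : 'rV[R]_n => \sum_(i <- s) x 0 i).
      by apply.
    elim=> [|i s IHs].
      rewrite (_ : (fun _ => _) = cst 0); first exact: cst_continuous.
      by apply/funext => y; rewrite big_nil.
    rewrite (_ : (fun _ => _) = fun x : 'rV[R]_n => x 0 i + \sum_(j <- s) x 0 j).
      by move=> y; exact: (cvgD (@coord_continuous R 1 n 0 i y) (IHs y)).
    by apply/funext => y; rewrite big_cons.
  apply/seteqP; split => x /=.
    move=> Sx; split; last by case: Sx.
    by move=> i; rewrite in_itv/= (simplex_le1 Sx) andbT; case: Sx.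
  by move=> [x0 x1]; split => // i; have := x0 i; rewrite in_itv/= => /andP[].
- move=> x y t [x0 x1] [y0 y1] /andP[t0 t1]; split.
    by move=> i; rewrite !mxE addr_ge0// mulr_ge0// subr_ge0.
  rewrite (eq_bigr (fun i => (1 - t) * x 0 i + t * y 0 i)) => [|i _]; last by rewrite !mxE.
  rewrite big_split/= -!mulr_sumr.
  have h1 : (1 - t) * \sum_i x 0 i <= 1 - t by rewrite ler_piMr// subr_ge0.
  have h2 : t * \sum_i y 0 i <= t by rewrite ler_piMr.
  by lra.
- move=> x d [x0 x1] d01; split.
    by move=> i; rewrite mxE mulr_ge0//; case/andP: (d01 i).
  apply: le_trans x1; apply: ler_sum => i _; rewrite mxE ler_piMl//.
  by case/andP: (d01 i).
Qed.

Lemma simplex0 : simplex 0.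
Proof.
split => [i|]; first by rewrite mxE.
by rewrite big1 ?ler01// => i _; rewrite mxE.
Qed.

Lemma volume_simplex_gt0 : (0 < volume simplex)%E.
Proof.
have [cS _ _] := shrink_body_simplex.
(* A cube of side 1/(n+1) fits, as n/(n+1) <= 1; n + 1 in place of n covers dimension 0. *)
apply: (@lt_le_trans _ _ (volume [set x : 'rV[R]_n | forall i, `[0, n.+1%:R^-1]%classic (x 0 i)])).
  by rewrite volume_box ?invr_ge0// lte_fin exprn_gt0// subr0 invr_gt0.
apply: le_volume; try by apply: measurable_rowset_compact => //; exact: compact_box.
move=> x xb; split => [i|]; first by have := xb i; rewrite /= in_itv/= => /andP[].
apply: (@le_trans _ _ (\sum_(i < n) n.+1%:R^-1)).
  by apply: ler_sum => i _; have := xb i; rewrite /= in_itv/= => /andP[].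
by rewrite sumr_const card_ord -[leLHS]mulr_natr mulrC ler_pdivrMr// mul1r ler_nat.
Qed.

Lemma volume_simplex_lty : (volume simplex < +oo)%E.
Proof.
have [cS _ _] := shrink_body_simplex.
apply: (@le_lt_trans _ _ (volume [set x : 'rV[R]_n | forall i, `[0, 1]%classic (x 0 i)])).
  apply: le_volume; try by apply: measurable_rowset_compact => //; exact: compact_box.
  move=> x Sx i /=; rewrite in_itv/= (simplex_le1 Sx) andbT; case: Sx => x0 _.
  exact: x0.
by rewrite volume_box// ltry.
Qed.

Lemma simplex_sub_split_sum E : simplex `<=` split_sum 1 E simplex.
Proof.
move=> z [z0 z1].
(* The parameter t is the mass be outside E, so the complementary block has exactly the mass
   available to it; the block of E has mass al <= 1 - be. *)
pose al := \sum_(i in E) z 0 i; pose be := \sum_(i in ~: E) z 0 i.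
have al0 : 0 <= al by exact: sumr_ge0.
have be0 : 0 <= be by exact: sumr_ge0.
have ab1 : al + be <= 1.
  rewrite (_ : al + be = \sum_i z 0 i)// (bigID (mem E))/=; congr (_ + _).
  by apply: eq_bigl => i; rewrite inE.
(* A block of mass at most c is c times a point of the simplex. For c = 0 the block vanishes and
   c^-1 = 0 gives the origin. *)
have part E' c : 0 <= c -> \sum_(i in E') z 0 i <= c ->
    simplex (c^-1 *: restr E' z) /\ restr E' z = c *: (c^-1 *: restr E' z).
  move=> c0 zc; split.
    split => [i|]; first by rewrite mxE restrE; case: ifP; rewrite ?mulr0// mulr_ge0// invr_ge0.
    rewrite (eq_bigr (fun i => c^-1 * (if i \in E' then z 0 i else 0))) => [|i _]; last first.
      by rewrite mxE restrE.
    rewrite -mulr_sumr -big_mkcond/=.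
    have [->|cn0] := eqVneq c 0; first by rewrite invr0 mul0r ler01.
    by rewrite mulrC ler_pdivrMr ?mul1r// lt_neqAle eq_sym cn0.
  have [cz|cn0] := eqVneq c 0; last by rewrite scalerA divff// scale1r.
  rewrite cz scale0r; apply/rowP => i; rewrite restrE mxE; case: ifP => // iE.
  apply/eqP; rewrite eq_le z0 andbT -cz; apply: le_trans zc.
  by rewrite (bigD1 i)//= lerDl sumr_ge0.
have be1 : 0 <= 1 - be by lra.
have [|Sx xE] := part E (1 - be) be1; first by rewrite -/al; lra.
have [|Sy yE] := part (~: E)%SET be be0; first by rewrite -/be.
exists (restr E ((1 - be)^-1 *: restr E z)), (restr (~: E) (be^-1 *: restr (~: E) z)), be.
split => //.
- by rewrite be0; lra.
- rewrite !powRr1//.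
  apply/rowP => i; move/(congr1 (fun w : 'rV[R]_n => w 0 i)) : xE.
  move/(congr1 (fun w : 'rV[R]_n => w 0 i)) : yE; rewrite !mxE inE.
  case: (i \in E) => /=; rewrite !(mul1r, mul0r, mulr0, addr0, add0r) //.
Qed.

Lemma volume_simplex_split_prod E :
  ('C(n, #|E|)%:R%:E * volume simplex <= volume (split_prod E simplex))%E.
Proof.
have gS := shrink_body_simplex; have [cS _ _] := gS.
have C0 : (0 < 'C(n, #|E|)%:R :> R) by rewrite ltr0n bin_gt0 card_set_ord.
have : (volume simplex <= volume (split_sum 1 E simplex))%E.
  apply: le_volume; last exact: simplex_sub_split_sum.
    exact: measurable_rowset_compact.
  exact: measurable_split_sum.
rewrite volume_split_sumE// split_coef1.
move/(lee_wpmul2l (x := 'C(n, #|E|)%:R%:E)); rewrite lee_fin (ltW C0) => /(_ isT).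
by rewrite muleA -EFinM divff ?gt_eqF// mul1e.
Qed.

(** Null set outside which the signs of a point determine its index E. *)
Definition coord_hyperplanes : set 'rV[R]_n := [set z | exists i, z 0 i = 0].

Lemma rowset_coord_hyperplanes :
  rowset coord_hyperplanes = \big[setU/set0]_(i < n) rowset [set z | z 0 i = 0].
Proof.
rewrite -bigcup_seq; apply/seteqP; split => t /=.
  by move=> [i ti]; exists i => //=; rewrite mem_index_enum.
by move=> [i _ ti]; exists i.
Qed.

Lemma measurable_coord_hyperplanes : measurable (rowset coord_hyperplanes).
Proof.
rewrite rowset_coord_hyperplanes; apply: bigsetU_measurable => i _.
exact: measurable_hyperplane.
Qed.

Lemma volume_coord_hyperplanes : volume coord_hyperplanes = 0%E.
Proof.
apply/eqP; rewrite eq_le measure_ge0 andbT volumeE rowset_coord_hyperplanes.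
apply: (le_trans (lebesgueRn_bigU (@measurable_hyperplane R n))).
by rewrite big1// => i _; exact: volume_hyperplane.
Qed.

Lemma reflected_sum_sub_power_sum r E K : shrinkable K ->
  reflected_sum r E K `<=` power_sum r K (neg_set K).
Proof.
move=> sK z [_ [_ [t [[x Kx <-] [y Ky <-] t01 zE]]]].
have rK E' w : K w -> K (restr E' w) by exact: shrinkable_restr.
exists (restr E x), (- restr (~: E) y), t; split => //; first exact: rK.
  by exists (restr (~: E) y) => //; exact: rK.
rewrite -[LHS](cmul_reflectK E) zE; apply/rowP => i; rewrite !mxE inE.
by case: (i \in E) => /=; ring.
Qed.

Lemma reflected_sum_sign r E (K : set 'rV[R]_n) z :
  (forall x, K x -> forall i, 0 <= x 0 i) -> reflected_sum r E K z ->
  forall i, 0 <= (if i \in E then z 0 i else - z 0 i).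
Proof.
move=> K0 [_ [_ [t [[x Kx <-] [y Ky <-] t01 /rowP zE]]]] i.
have -> : (if i \in E then z 0 i else - z 0 i) = cmul (reflect_out E) z 0 i.
  by rewrite !mxE; case: ifP; rewrite ?mul1r ?mulN1r.
rewrite zE mxE [X in X + _]mxE [X in _ + X]mxE !restrE.
by rewrite addr_ge0// mulr_ge0 ?powR_ge0//; case: ifP => // _; exact: K0.
Qed.

(** For K in the nonnegative orthant, a point of the part of index E is nonnegative on E and
    nonpositive elsewhere. Off the coordinate hyperplanes the parts are therefore disjoint, and
    their volumes add up. *)
Lemma sum_volume_reflected_le r K : 0 <= r -> shrink_body K ->
  (forall x, K x -> forall i, 0 <= x 0 i) ->
  (\sum_(E : {set 'I_n}) volume (reflected_sum r E K) <=
   volume (power_sum r K (neg_set K)))%E.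
Proof.
move=> r0 gK K0; have [cK _ sK] := gK.
pose N := rowset coord_hyperplanes.
have mN : measurable N by exact: measurable_coord_hyperplanes.
have mA E := measurable_reflected_sum E r0 cK.
pose F E := rowset (reflected_sum r E K) `\` N.
have mF E : measurable (F E) by exact: measurableD.
have FE E : volume (reflected_sum r E K) = mu (F E).
  rewrite volumeE (measureDI _ (mA E) mN) [X in (_ + X)%E](_ : _ = 0%E) ?adde0//.
  apply/eqP; rewrite eq_le measure_ge0 andbT.
  rewrite -[leRHS]volume_coord_hyperplanes; apply: le_measure; rewrite ?inE//.
  exact: measurableI.
have tF : trivIset [set: {set 'I_n}] F.
  apply/trivIsetP => E E' _ _ EE'; apply/seteqP; split => // t [[tE tN] [tE' _]].
  apply: tN; apply: contrapT => tN; move/eqP : EE'; apply.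
  apply/finset.setP => i.
  have := reflected_sum_sign K0 tE i; have := reflected_sum_sign K0 tE' i.
  set z := (\row_i tnth t i) 0 i => h1 h2.
  have z0 : z != 0 by apply/eqP => z0; apply: tN; exists i.
  case: (i \in E') h1; case: (i \in E) h2 => // h2 h1; exfalso; move/eqP: z0; apply; lra.
rewrite (eq_bigr (fun E => mu (F E))) => [|E _]; last exact: FE.
rewrite (_ : (\sum_E mu (F E) = mu (\bigcup_E F E))%E); last first.
  rewrite measure_fin_bigcup//; last exact: finite_finset.
  rewrite fsbig_seq ?index_enum_uniq//; apply: eq_fsbigl.
  by apply/seteqP; split => E //= _; rewrite mem_index_enum.
apply: le_measure; rewrite ?inE.
- by apply: fin_bigcup_measurable => //; exact: finite_finset.
- exact: measurable_rowset_power_sum_neg.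
- by move=> t [E _ [tE _]]; exact: reflected_sum_sub_power_sum tE.
Qed.

Lemma volume_power_sum_simplex q : 0 <= rinv q ->
  ((kappa n q)%:E * volume simplex <=
   volume (power_sum (rinv q) simplex (neg_set simplex)))%E.
Proof.
move=> r0; have gS := shrink_body_simplex; have [cS _ _] := gS.
apply: le_trans (sum_volume_reflected_le r0 gS _); last by move=> x [].
rewrite kappaE// -sumEFin ge0_sume_distrl; last first.
  by move=> E _; rewrite lee_fin mulr_ge0// split_coef_ge0.
apply: lee_sum => E _; rewrite volume_reflected_sum// volume_split_sumE//.
rewrite [(_ * _%:R)%:E]EFinM -muleA.
apply: lee_wpmul2l; first by rewrite lee_fin split_coef_ge0.
exact: volume_simplex_split_prod.
Qed.

End Simplex.

(** * The theorem in terms of p and q *)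

Lemma rinv_ge0 (R : realType) (q : \bar R) : (1 < q)%E -> 0 <= rinv q.
Proof.
by move=> q1; rewrite fine_ge0// inve_ge0 (le_trans _ (ltW q1))// lee01.
Qed.

Lemma Lp_sumE (R : realType) n (p : R) (q : \bar R) (K L : set 'rV[R]_n) :
  ((p%:E)^-1 + q^-1 = 1)%E -> (1 < q)%E -> Lp_sum p q K L = power_sum (rinv q) K L.
Proof.
move=> pq q1; rewrite /Lp_sum; case: eqP => // p1.
(* For p = 1 the relation between the exponents gives 1/q = 0. Both coefficients are then 1 for
   every t, and t = 0 below is an arbitrary choice. *)
have -> : rinv q = 0.
  rewrite /rinv; case: q q1 pq => [u| |]//=; rewrite p1 inve1 inver lte_fin => u1.
  by rewrite gt_eqF ?(lt_trans ltr01)// -EFinD => -[] /=; lra.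
apply/seteqP; split => z /=.
  move=> [x Kx [y Ly <-]]; exists x, y, 0; split; rewrite ?lexx ?ler01//.
  by rewrite !powRr0 !scale1r.
move=> [x [y [t [Kx Ly _ ->]]]]; exists x => //; exists y => //.
by rewrite !powRr0 !scale1r.
Qed.

Theorem lemma23 (R : realType) (n : nat) (p : R) (q : \bar R)
  (hp : 1 <= p) (hq : (1 < q)%E) (hpq : ((p%:E)^-1 + q^-1 = 1)%E) :
  (forall K : set 'rV[R]_n, locally_anti_blocking K ->
     (volume (Lp_sum p q K (neg_set K)) <=
      (kappa n q)%:E * volume K)%E) /\
  (forall c : R,
     (forall K : set 'rV[R]_n, locally_anti_blocking K ->
        (volume (Lp_sum p q K (neg_set K)) <= c%:E * volume K)%E) ->
     kappa n q <= c).
Proof.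
have r0 := rinv_ge0 hq; split => [K /locally_anti_blocking_shrink_body[_ gK]|c Hc].
  by rewrite Lp_sumE//; exact: volume_power_sum_neg_le.
have S0 := @volume_simplex_gt0 R n; have Soo := @volume_simplex_lty R n.
have labS : locally_anti_blocking (@simplex R n).
  by apply: shrink_body_locally_anti_blocking; [exists 0; exact: simplex0|exact: shrink_body_simplex].
have := Hc _ labS; rewrite Lp_sumE//.
move/(le_trans (volume_power_sum_simplex n r0)).
(* The volume of the simplex is finite and positive, so it cancels. *)
have /fineK <- : volume (@simplex R n) \is a fin_num by rewrite ge0_fin_numE// ltW.
by rewrite -!EFinM lee_fin ler_pM2r// fine_gt0// S0 Soo.
Qed.
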